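(* Assume that $\mathcal{B}\neq\emptyset$, fix an element $(\mathbf{b}_\tau)_{\tau\in\tilde{\mathcal{F}}}\in\mathcal{B}$, and let $\omega(S)$ be the associated subset of $\mathbb{Z}^d$. Then there exist one-to-one correspondences between left modules, left ideals, right modules, right ideals of $D(S)$ and right modules, right ideals, left modules, left ideals of $D(\omega(S))$, respectively.
   Context: $K$ is an algebraically closed field of characteristic zero. $A\subset\mathbb{Z}^d$ is a finite set with $\mathbb{Z}A=\mathbb{Z}^d$ and with strongly convex cone $\mathbb{R}_{\geq 0}A$; $\mathbb{N}A$ is the monoid generated by $A$. $\mathcal{F}$ is the set of facets of $\mathbb{R}_{\geq 0}A$. For $\sigma\in\mathcal{F}$, $F_\sigma$ is the unique linear form on $\mathbb{R}^d$ with $F_\sigma(\mathbb{R}_{\geq 0}A)\geq 0$, $F_\sigma(\sigma)=0$, $F_\sigma(\mathbb{Z}^d)=\mathbb{Z}$. For a face $\tau$, $\mathbb{Z}(A\cap\tau)$ is the group generated by $A\cap\tau$, and $K\tau\subseteq K^d$ is the $K$-linear span of $A\cap\tau$. $\tau\succeq\tau'$ means that $\tau'$ is a face of $\tau$. $T\subseteq\mathbb{Z}^d$ is an $\mathbb{N}A$-set if $T+\mathbb{N}A\subseteq T$; it is finitely generated if $T=G+\mathbb{N}A$ with $G$ finite; it is scored if $T=\bigcap_{\sigma\in\mathcal{F}}\{\mathbf{a}\in\mathbb{Z}^d:F_\sigma(\mathbf{a})\in F_\sigma(T)\}$. Standing setting: $S_c$ is a finitely generated scored $\mathbb{N}A$-set,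 $\mathbf{b}_1,\ldots,\mathbf{b}_m\in S_c$, $\tau_1,\ldots,\tau_m$ are faces of $\mathbb{R}_{\geq 0}A$, $S=S_c\setminus\bigcup_{i=1}^m(\mathbf{b}_i+\mathbb{Z}(A\cap\tau_i))$, this expression is irredundant (no $\mathbf{b}_i+\mathbb{Z}(A\cap\tau_i)$ can be omitted), $F_\sigma(S)=F_\sigma(S_c)$ for all $\sigma\in\mathcal{F}$, and $S$ is an $\mathbb{N}A$-set. $\tilde{\mathcal{F}}=\mathcal{F}\cup\{\tau_i: i=1,\ldots,m\}$. $\mathcal{B}$ is the set of families $(\mathbf{b}_\tau)_{\tau\in\tilde{\mathcal{F}}}$ with $\mathbf{b}_\tau\in (K\tau\cap\mathbb{Z}^d)/\mathbb{Z}(A\cap\tau)$ for all $\tau\in\tilde{\mathcal{F}}$ such that for all $i$ and all $\tau\in\tilde{\mathcal{F}}$ with $\tau\succeq\tau_i$ there exists $j$ with $\tau_j=\tau$ and $\mathbf{b}_i+\mathbf{b}_{\tau_i}=\mathbf{b}_j+\mathbf{b}_{\tau_j}$ mod $\mathbb{Z}(A\cap\tau)$. For a fixed $(\mathbf{b}_\tau)\in\mathcal{B}$, $$\omega(S)=\{\mathbf{a}\in\mathbb{Z}^d: -\mathbf{a}-\mathbf{b}_\tau\notin S+\mathbb{Z}(A\cap\tau)\text{ for each }\tau\in\tilde{\mathcal{F}}\}.$$ $D(\mathbb{Z}^d)=K[t_1^{\pm1},\ldots,t_d^{\pm1}]\langle\partial_1,\ldots,\partial_d\rangle$ acts on $K[t_1^{\pm1},\ldots,t_d^{\pm1}]$.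 For $T\subseteq\mathbb{Z}^d$, $K[T]=\bigoplus_{\mathbf{a}\in T}Kt^{\mathbf{a}}$ and $D(T)=\{P\in D(\mathbb{Z}^d):P(K[T])\subseteq K[T]\}$. *)

(* Defs.v *)
From HB Require Import structures.
From mathcomp Require Import all_boot all_order all_algebra finmap.
From mathcomp Require Import boolp classical_sets functions reals.
From mathcomp Require Import monalg.

Set Implicit Arguments.
Unset Strict Implicit.
Unset Printing Implicit Defensive.

Import Order.TTheory GRing.Theory Num.Theory.

Local Open Scope classical_set_scope.
Local Open Scope ring_scope.

Notation "''Z^' d" := 'rV[int]_d (at level 8, d at level 2, format "''Z^' d").

Definition to_space (F : pzRingType) d (a : 'Z^d) : 'rV[F]_d :=
  map_mx (fun z : int => z%:~R) a.

Definition addset (V : zmodType) (S T : set V) : set V :=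
  [set s + t | s in S & t in T].

Section Combinations.
Variables (d : nat) (A : {fset 'Z^d}).

Definition Nspan : set 'Z^d :=
  [set x | exists n : 'Z^d -> nat, x = \sum_(a <- A) a *+ n a].

Definition Zspan : set 'Z^d :=
  [set x | exists n : 'Z^d -> int, x = \sum_(a <- A) a *~ n a].

Definition Kspan (K : pzRingType) : set 'rV[K]_d :=
  [set x | exists c : 'Z^d -> K, x = \sum_(a <- A) c a *: to_space K a].

Definition cone (R : numDomainType) : set 'rV[R]_d :=
  [set x | exists2 c : 'Z^d -> R,
    forall a, 0 <= c a & x = \sum_(a <- A) c a *: to_space R a].

End Combinations.

Arguments Kspan {d} A K _.
Arguments cone {d} A R _.

Section Faces.
Variables (R : realType) (d : nat).

Definition strongly_convex (C : set 'rV[R]_d) : Prop :=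
  forall x, C x -> C (- x) -> x = 0.

(* The zero form is allowed, so that [C] is a face of itself. *)
Definition face (C t : set 'rV[R]_d) : Prop :=
  exists2 l : {scalar 'rV[R]_d},
    forall x, C x -> 0 <= l x & t = [set x | C x /\ l x = 0].

Definition facet (C s : set 'rV[R]_d) : Prop :=
  [/\ face C s, s <> C &
      forall t, face C t -> s `<=` t -> t = s \/ t = C].

Definition on_face (A : {fset 'Z^d}) (t : set 'rV[R]_d) : {fset 'Z^d} :=
  [fset a in A | to_space R a \in t]%fset.

Definition form_values (F : {scalar 'rV[R]_d}) (T : set 'Z^d) : set R :=
  [set F (to_space R a) | a in T].

(* When [A] generates Z^d, each facet [s] of the cone has exactly one form [F]
   with this property.  Below, statements about "the" form of [s] quantify over
   all [F] satisfying it. *)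
Definition facet_form (A : {fset 'Z^d}) (s : set 'rV[R]_d)
    (F : {scalar 'rV[R]_d}) : Prop :=
  [/\ forall x, cone A R x -> 0 <= F x,
      forall x, s x -> F x = 0 &
      form_values F setT = range (fun z : int => z%:~R : R)].

End Faces.

Section NASets.
Variables (R : realType) (d : nat) (A : {fset 'Z^d}).

Definition NAset (T : set 'Z^d) : Prop := addset T (Nspan A) `<=` T.

Definition fin_gen (T : set 'Z^d) : Prop :=
  exists G : {fset 'Z^d}, T = addset [set` G] (Nspan A).

Definition scored (T : set 'Z^d) : Prop :=
  T = [set a | forall s F, facet (cone A R) s -> facet_form A s F ->
                 form_values F T (F (to_space R a))].

End NASets.

Section Omega.
Variables (R : realType) (d : nat) (A : {fset 'Z^d}).
Variables (m : nat) (b : 'I_m -> 'Z^d) (tau : 'I_m -> set 'rV[R]_d).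

Definition hole (i : 'I_m) : set 'Z^d :=
  addset [set b i] (Zspan (on_face A (tau i))).

Definition Ftilde : set (set 'rV[R]_d) :=
  [set s | facet (cone A R) s] `|` range tau.

(* A family of classes in (K t \cap Z^d) / Z(A \cap t) is given by
   representatives [bt t]; its values outside [Ftilde] are irrelevant. *)
Definition calB (K : pzRingType) : set (set 'rV[R]_d -> 'Z^d) :=
  [set bt |
    (forall t, Ftilde t -> Kspan (on_face A t) K (to_space K (bt t))) /\
    (forall i t, Ftilde t -> face t (tau i) ->
       exists2 j, tau j = t &
         Zspan (on_face A t) ((b i + bt (tau i)) - (b j + bt (tau j))))].

Definition omega (S : set 'Z^d) (bt : set 'rV[R]_d -> 'Z^d) : set 'Z^d :=
  [set a | forall t, Ftilde t ->
     ~ addset S (Zspan (on_face A t)) (- a - bt t)].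

End Omega.

Section Endomorphisms.
Variables (K : comPzRingType) (V : lmodType K).

Definition endo := {linear V -> V}.

HB.instance Definition _ := gen_eqMixin endo.
HB.instance Definition _ := gen_choiceMixin endo.

Lemma endoP (f g : endo) : f =1 g -> f = g.
Proof.
move=> fg; have {}fg : (f : V -> V) = g by apply: funext.
case: f fg => f cf; case: g => g cg /= fg.
move: cf cg; rewrite fg => cf cg; congr GRing.Linear.Pack.
case: cf cg => [[cf1] [cf2]] [[cg1] [cg2]].
by rewrite (Prop_irrelevance cf1 cg1) (Prop_irrelevance cf2 cg2).
Qed.

Definition endo0 : endo := \0.
Definition endo_add (f g : endo) : endo := f \+ g.
Definition endo_opp (f : endo) : endo := \- f.
Definition endo1 : endo := idfun.
Definition endo_mul (f g : endo) : endo := f \o g.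

Let endo_addA : associative endo_add.
Proof. by move=> f g h; apply: endoP => v /=; rewrite addrA. Qed.
Let endo_addC : commutative endo_add.
Proof. by move=> f g; apply: endoP => v /=; rewrite addrC. Qed.
Let endo_add0 : left_id endo0 endo_add.
Proof. by move=> f; apply: endoP => v /=; rewrite add0r. Qed.
Let endo_addN : left_inverse endo0 endo_opp endo_add.
Proof. by move=> f; apply: endoP => v /=; rewrite addNr. Qed.

HB.instance Definition _ :=
  GRing.isZmodule.Build endo endo_addA endo_addC endo_add0 endo_addN.

Let endo_mulA : associative endo_mul.
Proof. by move=> f g h; apply: endoP. Qed.
Let endo_mul1l : left_id endo1 endo_mul.
Proof. by move=> f; apply: endoP. Qed.
Let endo_mul1r : right_id endo1 endo_mul.
Proof. by move=> f; apply: endoP. Qed.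
Let endo_mulDl : left_distributive endo_mul endo_add.
Proof. by move=> f g h; apply: endoP. Qed.
Let endo_mulDr : right_distributive endo_mul endo_add.
Proof. by move=> f g h; apply: endoP => v /=; rewrite raddfD. Qed.

HB.instance Definition _ :=
  GRing.Zmodule_isPzRing.Build endo endo_mulA endo_mul1l endo_mul1r
    endo_mulDl endo_mulDr.

End Endomorphisms.

Section DifferentialOperators.
Variables (K : fieldType) (d : nat).

(* [laurent] is the space of Laurent polynomials with its monomial basis:
   [<< c *g a >>] is c t^a. *)
Definition laurent := {malg K['Z^d]}.

Section LinearExtension.
Variable f : 'Z^d -> laurent.

Definition lin_ext_fun (g : laurent) : laurent :=
  \sum_(a <- msupp g) g@_a *: f a.

Lemma lin_ext_funEw (D : {fset 'Z^d}) g : (msupp g `<=` D)%fset ->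
  lin_ext_fun g = \sum_(a <- D) g@_a *: f a.
Proof.
move=> sgD; rewrite /lin_ext_fun (big_fset_incl _ sgD) // => a _ ag.
by rewrite mcoeff_outdom // scale0r.
Qed.

Lemma lin_ext_linear : linear lin_ext_fun.
Proof.
move=> c g h; pose D := (msupp (c *: g + h) `|` msupp g `|` msupp h)%fset.
rewrite !(@lin_ext_funEw D) /D; last first.
- by apply/fsubsetP => a; rewrite !inE => ->.
- by apply/fsubsetP => a; rewrite !inE => ->; rewrite orbT.
- by apply/fsubsetP => a; rewrite !inE => ->; rewrite !orbT.
rewrite scaler_sumr -big_split /=; apply: eq_bigr => a _.
by rewrite mcoeffD mcoeffZ scalerDl scalerA.
Qed.

HB.instance Definition _ :=
  GRing.isLinear.Build K laurent laurent *:%R lin_ext_fun lin_ext_linear.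

Definition lin_ext : endo laurent := lin_ext_fun.

End LinearExtension.

Lemma lin_extU f a : lin_ext f << a >> = f a.
Proof.
rewrite /= (@lin_ext_funEw _ [fset a]%fset).
  by rewrite big_seq_fset1 mcoeffUU scale1r.
by rewrite msuppU oner_eq0.
Qed.

Definition op_scale (c : K) : endo laurent := ( *:%R c : {linear _ -> _}).

Definition op_t (c : 'Z^d) : endo laurent := lin_ext (fun a => << a + c >>).

Definition op_d (i : 'I_d) : endo laurent :=
  lin_ext (fun a => << (a 0 i)%:~R *g a - delta_mx 0 i >>).

(* The ring D(Z^d), as the K-algebra of operators on the Laurent polynomials
   generated by the t^c and the partial derivatives; in characteristic zero
   K[t_1^{+-1},...,t_d^{+-1}]<d_1,...,d_d> acts faithfully. *)
Inductive torus_diffop : endo laurent -> Prop :=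
| Torus_scale (c : K) : torus_diffop (op_scale c)
| Torus_t c : torus_diffop (op_t c)
| Torus_d i : torus_diffop (op_d i)
| Torus_add P Q : torus_diffop P -> torus_diffop Q -> torus_diffop (P + Q)
| Torus_mul P Q : torus_diffop P -> torus_diffop Q -> torus_diffop (P * Q).

Definition laurent_on (T : set 'Z^d) : set laurent :=
  [set g | forall a, a \in msupp g -> T a].

Definition is_diffop (T : set 'Z^d) : {pred endo laurent} :=
  fun P => `[< torus_diffop P /\
              forall g, laurent_on T g -> laurent_on T (P g) >].

Lemma is_diffop_subring T : subring_closed (is_diffop T).
Proof.
split=> [|P Q|P Q].
- apply/asboolP; split=> //; rewrite (_ : 1 = op_scale 1).
    exact: Torus_scale.
  by apply: endoP => g /=; rewrite scale1r.
- move=> /asboolP[tP PT] /asboolP[tQ QT]; apply/asboolP; split.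
    apply: Torus_add => //.
    rewrite (_ : - Q = op_scale (-1) * Q).
      by apply: Torus_mul => //; exact: Torus_scale.
    by apply: endoP => g /=; rewrite scaleN1r.
  move=> g Tg a; rewrite -mcoeff_neq0 mcoeffB.
  have [Pa0|Pa0 _] := eqVneq ((P g)@_a) 0; last first.
    by apply: (PT g) => //; rewrite -mcoeff_neq0.
  by rewrite Pa0 sub0r oppr_eq0 mcoeff_neq0; exact: QT.
- move=> /asboolP[tP PT] /asboolP[tQ QT]; apply/asboolP; split.
    exact: Torus_mul.
  by move=> g Tg; apply: PT; apply: QT.
Qed.

Record diffop (T : set 'Z^d) := Diffop {
  diffop_val :> endo laurent;
  _ : diffop_val \in is_diffop T }.

HB.instance Definition _ T := [isSub for @diffop_val T].
HB.instance Definition _ T := [Choice of diffop T by <:].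
HB.instance Definition _ T :=
  GRing.SubChoice_isSubPzRing.Build (endo laurent) (is_diffop T) (diffop T)
    (is_diffop_subring T).

End DifferentialOperators.

Section Correspondences.

Definition left_ideal (R : pzRingType) (I : set R) : Prop :=
  [/\ I 0, forall x y, I x -> I y -> I (x + y) & forall a x, I x -> I (a * x)].

Definition right_ideal (R : pzRingType) (I : set R) : Prop :=
  [/\ I 0, forall x y, I x -> I y -> I (x + y) & forall a x, I x -> I (x * a)].

(* A bare bijection could exist for cardinality reasons alone, so the
   correspondence is required to respect inclusions; likewise, below, the
   correspondence of modules is required to be functorial. *)
Definition ideals_correspond (R R' : pzRingType)
    (P : set (set R)) (P' : set (set R')) : Prop :=
  exists2 f : set R -> set R', set_bij P P' f &
    forall I J, P I -> P J -> (I `<=` J <-> f I `<=` f J).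

(* An isomorphism between the categories of left modules over R and R'.  Right
   modules over R are left modules over the converse ring R^c. *)
Definition modules_correspond (R R' : pzRingType) : Prop :=
  exists (Phi : lmodType R -> lmodType R')
         (phi : forall M N : lmodType R,
            {linear M -> N} -> {linear Phi M -> Phi N}),
    [/\ bijective Phi,
        forall M N, bijective (phi M N),
        forall M (u : Phi M), phi M M idfun u = u &
        forall (M N P : lmodType R) (g : {linear N -> P}) (f : {linear M -> N})
               (u : Phi M),
          phi M P (g \o f) u = phi N P g (phi M N f u)].

End Correspondences.

(* Main.v *)
Require Import Defs.
From HB Require Import structures.
From mathcomp Require Import all_boot all_order all_algebra finmap.
From mathcomp Require Import boolp classical_sets functions reals.
From mathcomp Require Import monalg ring.

Set Implicit Arguments.
Unset Strict Implicit.
Unset Printing Implicit Defensive.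

Import Order.TTheory GRing.Theory Num.Theory.

Local Open Scope classical_set_scope.
Local Open Scope ring_scope.

(** All four correspondences come from one anti-isomorphism of rings between
D(S) and D(omega(S)).

An operator P on Laurent polynomials has a matrix P_(e,c), the coefficient of
t^e in P(t^c).  Reflecting the transpose, Q_(e,c) = P_(-c,-e), reverses
products and preserves D(Z^d): it fixes t^c and sends the Euler operator
t_i d_i to its opposite ([torus_adjoint]).  P preserves K[T] iff P_(e,c) = 0
for c in T and e outside T ([is_diffopP]), so P |-> Q carries the operators
preserving K[T] to those preserving K[W] with W = Z^d \ (-T).  For
W = omega(S) this T is the union of the sets b_t + S + Z(A \cap t), with t in
Ftilde ([coomega]), and it remains to see that D(S) = D(T).

For P in D(Z^d) and fixed a, the coefficient P_(c+a,c) is a polynomial in c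
([torus_coeff_poly]).  Hence D(S) = D(T) once, for each a, the same polynomials
vanish on S \ (S - a) and on T \ (T - a) ([vanish_S_coomega]).  Both sets are
contained in, and Zariski dense in, one explicit union of affine pieces
([exceptional]):
- the points x whose value F_sigma(x) lies in F_sigma(S) while F_sigma(x + a)
  does not, for a facet sigma;
- the points of b_i - a + K tau_i, whenever b_i - a is in S + Z(A \cap tau_i).
For S the density is seen by going to infinity inside the facet or inside
tau_i, which stays in S.  For T one goes to infinity in the opposite direction,
so that the forms of the facets not containing sigma, respectively tau_i,
become very negative.  This expels x + a from b_t + S + Z(A \cap t) when t lies
on such a facet.  If it does not, then t lies on sigma alone, where the value
at x + a is missing, respectively t contains tau_i, and the compatibility that
defines the family (b_t) puts x + a - b_t in a hole along t.

The polyhedral input is that the faces of the cone are intersections of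
facets, that each facet has a unique primitive integral form, that there are
finitely many of them, and that a facet spans the hyperplane of its form over
any field of characteristic zero.  It is obtained by rotating a supporting form
until its zeros determine it up to scaling ([exists_extremal]). *)

(** * Restriction of scalars and anti-isomorphic rings *)

Section RestrictionOfScalars.
Variables (R R' : pzRingType) (f : R' -> R).
Hypotheses (fD : {morph f : x y / x + y}) (fM : {morph f : x y / x * y}).
Hypothesis f1 : f 1 = 1.

Let f0 : f 0 = 0.
Proof. by apply: (addrI (f 0)); rewrite -fD !addr0. Qed.

Section Module.
Variable M : lmodType R.
Let scale (a : R') (v : M) := f a *: v.

Let scaleA a b v : scale a (scale b v) = scale (a * b) v.
Proof. by rewrite /scale scalerA fM. Qed.
Let scale0 v : scale 0 v = 0.
Proof. by rewrite /scale f0 scale0r. Qed.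
Let scale1 : left_id 1 scale.
Proof. by move=> v; rewrite /scale f1 scale1r. Qed.
Let scaleDr : right_distributive scale +%R.
Proof. by move=> a u v; rewrite /scale scalerDr. Qed.
Let scaleDl v : {morph scale^~ v : a b / a + b >-> a + b}.
Proof. by move=> a b; rewrite /scale fD scalerDl. Qed.

Let cM := GRing.Lmodule.class M.

(** The additive, choice and equality structures of M are kept as they are:
restricting back then returns M itself and not an isomorphic copy. *)
Definition restrict_mixin :=
  @GRing.Nmodule_isLSemiModule.Axioms_ R' M
    _ _
    (GRing.Lmodule.Algebra_BaseAddUMagma_isAddUMagma_mixin cM)
    (GRing.Lmodule.Algebra_BaseAddMagma_isAddMagma_mixin cM)
    _ _
    (GRing.Lmodule.Algebra_AddMagma_isAddSemigroup_mixin cM)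
    scale scaleA scale0 scale1 scaleDr scaleDl.

Definition restrict : lmodType R' :=
  GRing.Lmodule.Pack (GRing.Lmodule.Class
    (GRing.Lmodule.Algebra_BaseZmoduleNmodule_isZmodule_mixin
       (GRing.Lmodule.class M))
    restrict_mixin).

End Module.

Section Map.
Variables (M N : lmodType R) (h : {linear M -> N}).

Let h_scalable : GRing.scalable_for *:%R (h : restrict M -> restrict N).
Proof. by move=> a u; exact: (linearZ_LR h). Qed.

Definition restrict_map : {linear restrict M -> restrict N} :=
  @GRing.Linear.Pack _ (restrict M) (restrict N) _ h
    (@GRing.Linear.Class _ (restrict M) (restrict N) *:%R h
    (GRing.Linear.Algebra_isNmodMorphism_mixin (GRing.Linear.class h))
    (GRing.isScalable.Axioms_ (restrict M) (restrict N) *:%R h h_scalable)).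
End Map.

End RestrictionOfScalars.

Lemma linear_funext (R : pzRingType) (M N : lmodType R) (g h : {linear M ->
  N}) :
  g =1 h -> g = h.
Proof.
move=> gh; have {}gh : (g : M -> N) = h by apply: funext.
case: g gh => g cg; case: h => h ch /= gh.
move: cg ch; rewrite gh => cg ch; congr GRing.Linear.Pack.
case: cg ch => [[cg1] [cg2]] [[ch1] [ch2]].
by rewrite (Prop_irrelevance cg1 ch1) (Prop_irrelevance cg2 ch2).
Qed.

(** The axioms being propositions, a module structure on a fixed group is
determined by its scaling. *)
Lemma lmodule_mixin_eq (R : pzSemiRingType) T zero add um bm ch eq sg
    (m1 m2 : @GRing.Nmodule_isLSemiModule.axioms_ R T zero add um bm ch eq sg) :
  GRing.Nmodule_isLSemiModule.scale m1 = GRing.Nmodule_isLSemiModule.scale m2 ->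
  m1 = m2.
Proof.
case: m1 => sc1 A1 B1 C1 D1 E1; case: m2 => sc2 A2 B2 C2 D2 E2 /= sc12.
move: A1 B1 C1 D1 E1; rewrite sc12 => A1 B1 C1 D1 E1.
by rewrite (Prop_irrelevance A1 A2) (Prop_irrelevance B1 B2)
  (Prop_irrelevance C1 C2) (Prop_irrelevance D1 D2) (Prop_irrelevance E1 E2).
Qed.

Lemma restrictK (R R' : pzRingType) (f : R' -> R) (g : R -> R')
    (fD : {morph f : x y / x + y}) (fM : {morph f : x y / x * y}) (f1 : f 1 = 1)
    (gD : {morph g : x y / x + y}) (gM : {morph g : x y / x * y}) (g1 : g 1 =
      1) :
  cancel g f -> cancel (restrict fD fM f1) (restrict gD gM g1).
Proof.
move=> gK [T [opp zero add zm um bm ch eq sg [sc A0 A1 A2 A3 A4]]].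
rewrite /restrict /=; congr (GRing.Lmodule.Pack (GRing.Lmodule.Class _ _)).
apply: lmodule_mixin_eq; apply/funext => a; apply/funext => v.
by rewrite -[in RHS](gK a).
Qed.

Lemma ring_iso_modules (R R' : pzRingType) (f : R' -> R) (g : R -> R') :
  {morph f : x y / x + y} -> {morph f : x y / x * y} -> f 1 = 1 ->
  cancel f g -> cancel g f -> modules_correspond R R'.
Proof.
move=> fD fM f1 fK gK.
have gD : {morph g : x y / x + y}.
  by move=> x y; rewrite -[in LHS](gK x) -[in LHS](gK y) -fD fK.
have gM : {morph g : x y / x * y}.
  by move=> x y; rewrite -[in LHS](gK x) -[in LHS](gK y) -fM fK.
have g1 : g 1 = 1 by rewrite -f1 fK.
exists (restrict fD fM f1), (restrict_map fD fM f1); split=> //.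
  by exists (restrict gD gM g1); apply: restrictK.
move=> M N.
have back (h : {linear restrict fD fM f1 M -> restrict fD fM f1 N}) :
    GRing.scalable_for *:%R (h : M -> N).
  by move=> a u; have := linearZ_LR h (g a) u; rewrite /GRing.scale /= gK.
exists (fun h : {linear restrict fD fM f1 M -> restrict fD fM f1 N} =>
    @GRing.Linear.Pack _ M N _ h
    (@GRing.Linear.Class _ M N *:%R h
    (GRing.Linear.Algebra_isNmodMorphism_mixin (GRing.Linear.class h))
    (GRing.isScalable.Axioms_ M N *:%R h (back h)))).
  by move=> h; apply: linear_funext.
by move=> h; apply: linear_funext.
Qed.

Lemma ring_antiiso_ideals (R R' : pzRingType) (f : R -> R') (g : R' -> R) :
  {morph f : x y / x + y} -> {morph f : x y / x * y >-> y * x} ->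
  cancel f g -> cancel g f ->
  ideals_correspond (@left_ideal R) (@right_ideal R') /\
  ideals_correspond (@right_ideal R) (@left_ideal R').
Proof.
move=> fD fM fK gK.
have f0 : f 0 = 0 by apply: (addrI (f 0)); rewrite -fD !addr0.
have imE (I : set R) y : (f @` I) y <-> I (g y).
  by split=> [[x Ix <-]|Iy]; [rewrite fK | exists (g y)].
have fsub (I J : set R) : I `<=` J <-> f @` I `<=` f @` J.
  split=> IJ x.
    by move=> /imE /IJ Jx; apply/imE.
  by rewrite -[x]fK => /imE /IJ /imE.
have finj (I J : set R) : f @` I = f @` J -> I = J.
  by move=> IJ; apply/seteqP; split; apply/fsub; rewrite IJ.
have fsurj (J : set R') : J = f @` (g @` J).
  apply/seteqP; split=> [y Jy|y /imE [x Jx]].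
    by apply/imE; exists y.
  by move=> /(can_inj gK) <-.
have gE (J : set R') x : (g @` J) x <-> J (f x).
  by split=> [[y Jy <-]|Jx]; [rewrite gK | exists (f x)].
split; exists (fun I => f @` I); try (by move=> I J _ _; exact: fsub);
  split; try (by move=> I J _ _ /finj).
- move=> I [I0 ID IM]; split; first by exists 0.
    by move=> _ _ [x Ix <-] [y Iy <-]; exists (x + y) => //; exact: ID.
  by move=> a _ [x Ix <-]; exists (g a * x); [exact: IM | rewrite fM gK].
- move=> J [J0 JD JM]; exists (g @` J); last by rewrite -fsurj.
  split; first by apply/gE; rewrite f0.
    by move=> x y /gE Jx /gE Jy; apply/gE; rewrite fD; exact: JD.
  by move=> a x /gE Jx; apply/gE; rewrite fM; exact: JM.
- move=> I [I0 ID IM]; split; first by exists 0.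
    by move=> _ _ [x Ix <-] [y Iy <-]; exists (x + y) => //; exact: ID.
  by move=> a _ [x Ix <-]; exists (x * g a); [exact: IM | rewrite fM gK].
- move=> J [J0 JD JM]; exists (g @` J); last by rewrite -fsurj.
  split; first by apply/gE; rewrite f0.
    by move=> x y /gE Jx /gE Jy; apply/gE; rewrite fD; exact: JD.
  by move=> a x /gE Jx; apply/gE; rewrite fM; exact: JM.
Qed.

Lemma ring_antiiso_correspond (R R' : pzRingType) (f : R -> R') (g : R' -> R) :
  {morph f : x y / x + y} -> {morph f : x y / x * y >-> y * x} -> f 1 = 1 ->
  cancel f g -> cancel g f ->
  [/\ modules_correspond R R'^c,
      ideals_correspond (@left_ideal R) (@right_ideal R'),
      modules_correspond R^c R' &
      ideals_correspond (@right_ideal R) (@left_ideal R')].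
Proof.
move=> fD fM f1 fK gK; have [LR RL] := ring_antiiso_ideals fD fM fK gK.
have gD : {morph g : x y / x + y}.
  by move=> x y; rewrite -[in LHS](gK x) -[in LHS](gK y) -fD fK.
have gM : {morph g : x y / x * y >-> y * x}.
  by move=> x y; rewrite -[in LHS](gK x) -[in LHS](gK y) -fM fK.
have g1 : g 1 = 1 by rewrite -f1 fK.
split=> //.
- apply: (@ring_iso_modules R R'^c g f) => // x y; exact: gM.
- apply: (@ring_iso_modules R^c R' g f) => // x y; exact: gM.
Qed.

(** * Operators on Laurent polynomials and their transposes *)

Section Operators.
Variables (K : fieldType) (d : nat).
Implicit Types (P Q : endo (laurent K d)) (c e : 'Z^d).

Lemma mcoeff_sum (I : Type) (r : seq I) (p : pred I) (F : I -> laurent K d) e :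
  (\sum_(i <- r | p i) F i)@_e = \sum_(i <- r | p i) (F i)@_e.
Proof. exact: raddf_sum. Qed.

Lemma mcoeff_mono k c e : (<< k *g c >> : laurent K d)@_e = k * (c == e)%:R.
Proof. by rewrite mcoeffU mulr_natr. Qed.

Lemma mcoeff_scale k (g : laurent K d) e : (k *: g)@_e = k * g@_e.
Proof. exact: mcoeffZ. Qed.

Lemma mcoeff_add (g h : laurent K d) e : (g + h)@_e = g@_e + h@_e.
Proof. exact: mcoeffD. Qed.

Lemma malgU_scale k c : << k *g c >> = k *: << c >> :> laurent K d.
Proof.
apply/malgP => l; apply: (etrans (mcoeff_mono k c l)); apply: esym.
by rewrite mcoeff_scale (mcoeff_mono 1 c l) mul1r.
Qed.

Lemma malg_basis (g : laurent K d) (D : {fset 'Z^d}) :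
  (msupp g `<=` D)%fset -> g = \sum_(k <- D) g@_k *: << k >>.
Proof.
move=> gD; rewrite {1}(monalgEw gD); apply: eq_bigr => k _.
exact: malgU_scale.
Qed.

Lemma mcoeff_endo P (g : laurent K d) (D : {fset 'Z^d}) e :
  (msupp g `<=` D)%fset ->
  (P g)@_e = \sum_(k <- D) g@_k * (P << k >>)@_e.
Proof.
move=> /malg_basis {1}->; rewrite linear_sum.
rewrite mcoeff_sum; apply: eq_bigr => k _.
by rewrite linearZ_LR mcoeff_scale.
Qed.

Lemma endo_eq P Q :
  (forall c e, (P << c >>)@_e = (Q << c >>)@_e) -> P = Q.
Proof.
move=> PQ; apply: endoP => g; apply/malgP => e.
rewrite !(@mcoeff_endo _ _ (msupp g)) //.
by apply: eq_bigr => k _; rewrite PQ.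
Qed.

(** In terms of matrices on monomials, Q is the transpose of P reflected by
c |-> - c; equivalently it is the adjoint of P for the pairing
(g, h) |-> constant term of g h. *)
Definition adjoint P Q : Prop :=
  forall c e, (Q << c >>)@_e = (P << - e >>)@_(- c).

Lemma adjoint_sym P Q : adjoint P Q -> adjoint Q P.
Proof. by move=> PQ c e; rewrite PQ !opprK. Qed.

Lemma adjoint_uniq P Q Q' : adjoint P Q -> adjoint P Q' -> Q = Q'.
Proof. by move=> PQ PQ'; apply: endo_eq => c e; rewrite PQ PQ'. Qed.

Lemma adjoint1 : adjoint 1 1.
Proof.
move=> c e; apply: (etrans (mcoeff_mono 1 c e)).
apply: (etrans _ (esym (mcoeff_mono 1 (- e) (- c)))).
by rewrite eqr_opp eq_sym.
Qed.

Lemma adjointD P P' Q Q' :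
  adjoint P Q -> adjoint P' Q' -> adjoint (P + P') (Q + Q').
Proof. by move=> PQ PQ' c e /=; rewrite !mcoeff_add PQ PQ'. Qed.

Lemma adjointM P P' Q Q' :
  adjoint P Q -> adjoint P' Q' -> adjoint (P * P') (Q' * Q).
Proof.
move=> PQ PQ' c e /=.
pose D := (msupp (Q << c >>) `|` [fset - k | k in msupp (P' << - e >>)])%fset.
rewrite (@mcoeff_endo _ _ D) ?fsubsetUl //.
rewrite (@mcoeff_endo _ _ [fset - k | k in D]%fset).
  rewrite [RHS]big_imfset; last by move=> x y _ _ /oppr_inj.
  by apply: eq_bigr => k _; rewrite (PQ c k) (PQ' k e); exact: mulrC.
apply/fsubsetP => k k_supp; apply/imfsetP; exists (- k); rewrite ?opprK //.
by rewrite inE; apply/orP; right; apply/imfsetP; exists k.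
Qed.

Lemma op_scale_coeff (k : K) c e : (op_scale d k << c >>)@_e = k * (c == e)%:R.
Proof.
apply: (etrans (mcoeff_scale k << c >> e)); congr (_ * _).
by rewrite (mcoeff_mono 1 c e) mul1r.
Qed.

Lemma op_t_coeff a c e : (op_t K a << c >>)@_e = (c + a == e)%:R :> K.
Proof. by rewrite lin_extU (mcoeff_mono 1 (c + a) e) mul1r. Qed.

Lemma op_d_coeff i c e :
  (op_d K i << c >>)@_e = (c 0 i)%:~R * (c - delta_mx 0 i == e)%:R.
Proof. by rewrite lin_extU; exact: mcoeff_mono. Qed.

(** Adjoints exist on generators and adjunction reverses products.  Writing a
partial derivative as t^(-delta_i) (t_i d_i) and using that t_i d_i goes to its
opposite gives the correction term t^(-delta_i) below. *)
Lemma torus_adjoint P : torus_diffop P ->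
  exists2 Q, torus_diffop Q & adjoint P Q.
Proof.
elim=> {P} [c|c|i|P P' _ [Q tQ PQ] _ [Q' tQ' PQ']|P P' _ [Q tQ PQ] _ [Q' tQ'
  PQ']].
- exists (op_scale d c); first exact: Torus_scale.
  move=> u e; apply: (etrans (op_scale_coeff c u e)).
  apply: (etrans _ (esym (op_scale_coeff c (- e) (- u)))).
  by rewrite eqr_opp eq_sym.
- exists (op_t K c); first exact: Torus_t.
  move=> u e; apply: (etrans (op_t_coeff c u e)).
  apply: (etrans _ (esym (op_t_coeff c (- e) (- u)))).
  congr (_%:R); congr nat_of_bool.
  by rewrite -[RHS]eqr_opp opprK opprD opprK subr_eq eq_sym.
- exists (op_scale d (-1) * op_d K i + op_t K (- delta_mx 0 i)).
    apply: Torus_add; last exact: Torus_t.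
    by apply: Torus_mul; [exact: Torus_scale | exact: Torus_d].
  move=> u e.
  apply: (etrans (mcoeff_add (-1 *: op_d K i << u >>)
                             (op_t K (- delta_mx 0 i) << u >>) e)).
  apply: (etrans _ (esym (op_d_coeff i (- e) (- u)))).
  apply: (etrans (congr2 +%R (mcoeff_scale (-1) (op_d K i << u >>) e)
                             (op_t_coeff (- delta_mx 0 i) u e))).
  rewrite (op_d_coeff i u e).
  have -> : (- e - delta_mx 0 i == - u) = (u - delta_mx 0 i == e).
    by rewrite -opprD eqr_opp subr_eq eq_sym.
  case: eqP => [<-|_]; last by rewrite !mulr0 addr0.
  by rewrite !mxE !mulr1 eqxx /= opprB mulN1r addrC intrB eqxx.
- by exists (Q + Q'); [exact: Torus_add | exact: adjointD].
- by exists (Q' * Q); [exact: Torus_mul | exact: adjointM].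
Qed.

(** Polynomials enter only through their values and their restrictions to
lines, so they are represented as functions. *)
Inductive polyfun : ('rV[K]_d -> K) -> Prop :=
| Poly_const k : polyfun (fun=> k)
| Poly_coord i : polyfun (fun x => x 0 i)
| Poly_add f g : polyfun f -> polyfun g -> polyfun (fun x => f x + g x)
| Poly_mul f g : polyfun f -> polyfun g -> polyfun (fun x => f x * g x).

Lemma polyfun_shift f v : polyfun f -> polyfun (fun x => f (x + v)).
Proof.
elim=> {f} [k|i|f g _ pf _ pg|f g _ pf _ pg].
- exact: Poly_const.
- rewrite (_ : (fun x : 'rV[K]_d => _) = fun x : 'rV_d => x 0 i + v 0 i).
    by apply: Poly_add; [exact: Poly_coord | exact: Poly_const].
  by apply/funext => x; rewrite mxE.
- exact: Poly_add.
- exact: Poly_mul.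
Qed.

Lemma polyfun_line f p v : polyfun f ->
  exists q : {poly K}, forall k, f (p + k *: v) = q.[k].
Proof.
elim=> {f} [k|i|f g _ [q1 pf] _ [q2 pg]|f g _ [q1 pf] _ [q2 pg]].
- by exists k%:P => l; rewrite hornerC.
- by exists ((p 0 i)%:P + v 0 i *: 'X) => k; rewrite !mxE !hornerE mulrC.
- by exists (q1 + q2) => k; rewrite hornerD pf pg.
- by exists (q1 * q2) => k; rewrite hornerM pf pg.
Qed.

Lemma to_spaceD (F : pzRingType) (a b : 'Z^d) :
  to_space F (a + b) = to_space F a + to_space F b.
Proof. by apply/rowP => i; rewrite !mxE rmorphD. Qed.

(** P is a finite sum of terms t^(s i) (f i)(t_1 d_1, ..., t_d d_d).  Moving
t^(r j) to the left of f i in a product shifts the argument of f i by r j. *)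
Lemma torus_normal_form P : torus_diffop P ->
  exists (I : finType) (s : I -> 'Z^d) (f : I -> 'rV[K]_d -> K),
    (forall i, polyfun (f i)) /\
    forall c, P << c >> = \sum_i f i (to_space K c) *: << c + s i >>.
Proof.
elim=> {P} [k|a|i|P P' _ [I [s [f [pf Pf]]]] _ [J [r [g [pg Pg]]]]
                 |P P' _ [I [s [f [pf Pf]]]] _ [J [r [g [pg Pg]]]]].
- exists unit, (fun=> 0), (fun _ _ => k); split=> [_|c];
  first exact: Poly_const.
  by rewrite (big_pred1 tt) ?addr0 //; case.
- exists unit, (fun=> a), (fun _ _ => 1); split=> [_|c];
  first exact: Poly_const.
  by rewrite (big_pred1 tt) ?scale1r ?lin_extU //; case.
- exists unit, (fun=> - delta_mx 0 i), (fun _ x => x 0 i).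
  split=> [_|c]; first exact: Poly_coord.
  rewrite (big_pred1 tt); last by case.
  rewrite [LHS]lin_extU.
  by rewrite malgU_scale mxE.
- exists (I + J)%type, (fun x => match x with inl i => s i | inr j => r j end).
  exists (fun x => match x with inl i => f i | inr j => g j end).
  split=> [[]//|c]; rewrite big_sumType /= -Pf -Pg //.
- exists (I * J)%type, (fun x => r x.2 + s x.1).
  exists (fun x y => f x.1 (y + to_space K (r x.2)) * g x.2 y); split=> [x|c].
    by apply: Poly_mul; [exact: polyfun_shift | exact: pg].
  have -> : (P * P') << c >> = P (P' << c >>) by [].
  rewrite Pg linear_sum.
  rewrite -(pair_bigA _ (fun i j =>
     (f i (to_space K c + to_space K (r j)) * g j (to_space K c))
       *: << c + (r j + s i) >>)) exchange_big /=.
  apply: eq_bigr => j _; rewrite linearZ_LR Pf scaler_sumr;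
    apply: eq_bigr => i _.
  by rewrite scalerA mulrC to_spaceD addrA.
Qed.

Lemma polyfun_sum (I : Type) (r : seq I) (p : pred I) (f : I -> 'rV[K]_d -> K) :
  (forall i, polyfun (f i)) -> polyfun (fun x => \sum_(i <- r | p i) f i x).
Proof.
move=> pf; elim: r => [|i r IHr].
  rewrite (_ : (fun x : 'rV[K]_d => _) = fun=> 0); first exact: Poly_const.
  by apply/funext => x; rewrite big_nil.
case pi: (p i); last first.
  rewrite (_ : (fun x : 'rV[K]_d => _) = fun x => \sum_(i <- r | p i) f i x) //.
  by apply/funext => x; rewrite big_cons pi.
rewrite (_ : (fun x : 'rV[K]_d => _) = fun x =>
  f i x + \sum_(i <- r | p i) f i x).
  exact: Poly_add.
by apply/funext => x; rewrite big_cons pi.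
Qed.

Lemma torus_coeff_poly P a : torus_diffop P ->
  exists2 f, polyfun f & forall c, (P << c >>)@_(c + a) = f (to_space K c).
Proof.
move=> /torus_normal_form [I [s [f [pf Pf]]]].
exists (fun x => \sum_(i <- index_enum I | s i == a) f i x).
  exact: polyfun_sum.
move=> c; rewrite Pf mcoeff_sum [RHS]big_mkcond /=.
apply: eq_bigr => i _; rewrite mcoeff_scale (mcoeff_mono 1 (c + s i)) mul1r
  (inj_eq (addrI _)).
by case: eqP => _; rewrite ?mulr1 ?mulr0.
Qed.

Lemma is_diffopP (T : set 'Z^d) P : torus_diffop P ->
  P \in is_diffop T <-> forall c e, T c -> ~ T e -> (P << c >>)@_e = 0.
Proof.
move=> tP; split=> [/asboolP[_ PT] c e Tc Te|PT].
  apply/eqP; rewrite mcoeff_eq0; apply/negP => /(PT << c >>) Pe; apply: Te.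
  by apply: Pe => a /(fsubsetP msuppU_le); rewrite inE => /eqP ->.
apply/asboolP; split=> // g Tg e; rewrite -mcoeff_neq0.
apply: contra_neqP => Te.
rewrite (@mcoeff_endo _ _ (msupp g)) // big_seq big1 // => k kg.
by rewrite PT ?mulr0 //; exact: Tg.
Qed.

(** The hypothesis says, degree by degree, that an operator preserves K[S] iff
it preserves K[T], where T is the complement of - W; adjunction exchanges the
latter condition with the preservation of K[W]. *)
Lemma diffop_antiiso (S W : set 'Z^d) :
  (forall P a, torus_diffop P ->
     (forall c, S c -> ~ S (c + a) -> (P << c >>)@_(c + a) = 0) <->
     (forall c, ~ W (- c) -> W (- (c + a)) -> (P << c >>)@_(c + a) = 0)) ->
  exists (f : diffop K S -> diffop K W) (g : diffop K W -> diffop K S),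
  [/\ {morph f : x y / x + y}, {morph f : x y / x * y >-> y * x}, f 1 = 1,
    cancel f g & cancel g f].
Proof.
move=> SW.
have torusS (T : set 'Z^d) (P : diffop K T) : torus_diffop (val P).
  by have /asboolP[] := valP P.
have adjSW P Q : torus_diffop P -> torus_diffop Q -> adjoint P Q ->
    P \in is_diffop S <-> Q \in is_diffop W.
  move=> tP tQ PQ; split=> [/(is_diffopP _ tP)|/(is_diffopP _ tQ)] PT.
    apply/(is_diffopP _ tQ) => c e Wc We; rewrite PQ.
    have := (SW P (e - c) tP).1 (fun u => PT u _) (- e).
    by rewrite addKr !opprK; apply.
  apply/(is_diffopP _ tP) => c e Sc Se.
  have := (SW P (e - c) tP).2 _ c; rewrite (addrC c) subrK; apply=> // u Wu We.
  by have := PT _ _ We Wu; rewrite PQ !opprK.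
have transpose (T T' : set 'Z^d) : (forall P Q, torus_diffop P ->
      torus_diffop Q -> adjoint P Q -> P \in is_diffop T ->
        Q \in is_diffop T') ->
    exists f : diffop K T -> diffop K T',
      forall P : diffop K T, adjoint (val P) (val (f P)).
  move=> TT'; suff /choice[f fP] : forall P : diffop K T,
      exists Q : diffop K T', adjoint (val P) (val Q) by exists f.
  move=> P.
  have [Q tQ PQ] := torus_adjoint (torusS _ P).
  by exists (Diffop (TT' _ _ (torusS _ P) tQ PQ (valP P))).
have [f fP] := transpose S W (fun P Q tP tQ PQ => (adjSW P Q tP tQ PQ).1).
have [g gP] := transpose W S (fun P Q tP tQ PQ =>
  (adjSW Q P tQ tP (adjoint_sym PQ)).2).
exists f, g; split.
- move=> P Q; apply: val_inj; apply: (adjoint_uniq (fP _)).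
  exact: (adjointD (fP P) (fP Q)).
- move=> P Q; apply: val_inj; apply: (adjoint_uniq (fP _)).
  exact: (adjointM (fP P) (fP Q)).
- by apply: val_inj; apply: (adjoint_uniq (fP _)); exact: adjoint1.
- by move=> P; apply: val_inj; apply: (adjoint_uniq (gP _)); exact: adjoint_sym.
- by move=> P; apply: val_inj; apply: (adjoint_uniq (fP _)); exact: adjoint_sym.
Qed.
End Operators.
(** * Zariski density of lattice cones *)

Section Density.
Variables (K : fieldType) (d : nat).
Hypothesis charK : [pchar K] =i pred0.

Lemma intr_inj_char0 : injective (intr : int -> K).
Proof.
move=> x y /eqP; rewrite -subr_eq0 -intrB => /eqP xy0.
apply/eqP; rewrite -subr_eq0; move: (x - y) xy0 => {x y} [n|n] /eqP.
  by rewrite -pmulrn ((pcharf0P _).1 charK).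
by rewrite NegzE mulrNz oppr_eq0 -pmulrn ((pcharf0P _).1 charK).
Qed.

Lemma poly_infinite_roots (q : {poly K}) (u : nat -> K) :
  injective u -> (forall n, q.[u n] = 0) -> q = 0.
Proof.
move=> inj_u q0; apply/eqP; apply: contraT => /max_poly_roots roots_lt.
have := roots_lt [seq u i | i <- iota 0 (size q)].
rewrite size_map size_iota ltnn map_inj_uniq // iota_uniq; apply=> //.
by apply/allP => _ /mapP[n _ ->]; rewrite rootE q0.
Qed.

(** A product of infinite subsets of K is Zariski dense: the variables are freed
one at a time, each by counting the roots of a univariate polynomial. *)
Lemma polyfun_grid_zero (T : eqType) (v : T -> 'rV[K]_d) (u : nat -> K)
    (f : 'rV[K]_d -> K) (s : seq T) p :
  injective u -> polyfun f -> uniq s ->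
  (forall n : T -> nat, f (p + \sum_(a <- s) u (n a) *: v a) = 0) ->
  forall c : T -> K, f (p + \sum_(a <- s) c a *: v a) = 0.
Proof.
move=> inj_u pf; elim: s p => [|a s IHs] p /=.
  by move=> _ f0 c; have := f0 (fun=> 0%N); rewrite !big_nil.
move=> /andP[a_s uniq_s] f0 c; rewrite big_cons addrCA addrC.
have [q fq] := polyfun_line (p + \sum_(b <- s) c b *: v b) (v a) pf.
rewrite fq (@poly_infinite_roots q u inj_u) ?horner0 // => n0.
rewrite -fq addrAC; apply: IHs => // n.
have := f0 [eta n with a |-> n0]; rewrite big_cons /= eqxx addrA.
move=> f0n; rewrite -[RHS]f0n; congr (f (_ + _)); rewrite big_seq [RHS]big_seq.
apply: eq_bigr => b bs; congr (u _ *: _).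
by case: eqP bs a_s => // -> ->.
Qed.

Lemma to_spaceN (F : pzRingType) (a : 'Z^d) : to_space F (- a) = - to_space F a.
Proof. by apply/rowP => i; rewrite !mxE rmorphN. Qed.

Lemma to_space0 (F : pzRingType) : to_space F (0 : 'Z^d) = 0.
Proof. by apply/rowP => i; rewrite !mxE. Qed.

Lemma to_space_sum (F : pzRingType) I (r : seq I) (h : I -> 'Z^d) :
  to_space F (\sum_(i <- r) h i) = \sum_(i <- r) to_space F (h i).
Proof.
by elim/big_rec2: _ => [|i x y _ <-]; rewrite ?to_space0 ?to_spaceD.
Qed.

Lemma to_spaceMz (F : pzRingType) (a : 'Z^d) (n : int) :
  to_space F (a *~ n) = n%:~R *: to_space F a.
Proof.
by apply/rowP => i; rewrite -scaler_int intz !mxE intrM.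
Qed.

Lemma KspanD (B : {fset 'Z^d}) (F : pzRingType) x y :
  Kspan B F x -> Kspan B F y -> Kspan B F (x + y).
Proof.
move=> [c ->] [e ->]; exists (fun a => c a + e a).
by rewrite -big_split; apply: eq_bigr => a _; rewrite scalerDl.
Qed.

Lemma KspanZ (B : {fset 'Z^d}) (F : pzRingType) k x :
  Kspan B F x -> Kspan B F (k *: x).
Proof.
move=> [c ->]; exists (fun a => k * c a).
by rewrite scaler_sumr; apply: eq_bigr => a _; rewrite scalerA.
Qed.

Lemma Zspan_Kspan (B : {fset 'Z^d}) (F : pzRingType) x :
  Zspan B x -> Kspan B F (to_space F x).
Proof.
move=> [n ->]; exists (fun a => (n a)%:~R).
by rewrite to_space_sum; apply: eq_bigr => a _; rewrite to_spaceMz.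
Qed.

Lemma Kspan_subset (B B' : {fset 'Z^d}) (F : pzRingType) x :
  (B `<=` B')%fset -> Kspan B F x -> Kspan B' F x.
Proof.
move=> BB' [c ->]; exists (fun a => if a \in B then c a else 0).
rewrite -[RHS](big_fset_incl _ BB') /=; last first.
  by move=> a _ /negbTE ->; rewrite scale0r.
by apply: eq_big_seq => a ->.
Qed.

(** A translated lattice cone is Zariski dense in the affine space it spans.
The bound N leaves the freedom to go as deep into the cone as needed, and
e = -1 gives the opposite cone. *)
Lemma polyfun_zero_span (f : 'rV[K]_d -> K) (B : {fset 'Z^d}) (e : int)
    (N : nat) (x y : 'Z^d) :
  polyfun f -> e != 0 ->
  (forall n : 'Z^d -> nat,
     f (to_space K (x + \sum_(a <- B) a *~ (e * (N + n a)%N%:Z))) = 0) ->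
  Kspan B K (to_space K (y - x)) -> f (to_space K y) = 0.
Proof.
move=> pf e0 fx [c yx].
have -> : to_space K y = to_space K x + \sum_(a <- B) c a *: to_space K a.
  by rewrite -yx -to_spaceD addrC subrK.
apply: (polyfun_grid_zero (u := fun n => (e * (N + n)%N%:Z)%:~R)) => //.
  move=> n n' /intr_inj_char0 /(mulfI e0) [] /addnI //.
move=> n; rewrite -(fx n) to_spaceD to_space_sum.
by congr (f (_ + _)); apply: eq_bigr => a _; rewrite to_spaceMz.
Qed.

End Density.
(** * Linear forms as column vectors *)

Section Pairing.
Variables (F : comPzRingType) (d : nat).

Definition dot (g : 'cV[F]_d) (x : 'rV[F]_d) : F := (x *m g) 0 0.

Lemma dot_linear g : linear_for *%R (dot g).
Proof. by move=> k x y; rewrite /dot mulmxDl -scalemxAl !mxE. Qed.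

HB.instance Definition _ g :=
  GRing.isLinear.Build F 'rV[F]_d F *%R (dot g) (dot_linear g).

Lemma dotZl k g x : dot (k *: g) x = k * dot g x.
Proof. by rewrite /dot -scalemxAr mxE. Qed.

Lemma dotDl g h x : dot (g + h) x = dot g x + dot h x.
Proof. by rewrite /dot mulmxDr mxE. Qed.

Lemma dotZr k g x : dot g (k *: x) = k * dot g x.
Proof. by rewrite linearZ. Qed.

Lemma dotDr g x y : dot g (x + y) = dot g x + dot g y.
Proof. by rewrite linearD. Qed.

Lemma dotBr g x y : dot g (x - y) = dot g x - dot g y.
Proof. by rewrite linearB. Qed.

Lemma dot_sumr I (r : seq I) (h : I -> 'rV[F]_d) g :
  dot g (\sum_(i <- r) h i) = \sum_(i <- r) dot g (h i).
Proof. by rewrite linear_sum. Qed.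

Lemma dotMn g x n : dot g (x *+ n) = dot g x *+ n.
Proof. by rewrite raddfMn. Qed.

Lemma dotMz g x n : dot g (x *~ n) = dot g x *~ n.
Proof. by rewrite raddfMz. Qed.

Lemma dot_delta g i : dot g (delta_mx 0 i) = g i 0.
Proof. by rewrite /dot -rowE mxE. Qed.

Lemma scalar_dot (l : {scalar 'rV[F]_d}) x :
  l x = dot (\col_i l (delta_mx 0 i)) x.
Proof.
rewrite {1}(row_sum_delta x) linear_sum /dot mxE.
by apply: eq_bigr => i _; rewrite linearZ mxE.
Qed.

End Pairing.

Lemma dot_to_space (F : comPzRingType) d (z : 'cV[int]_d) (a : 'Z^d) :
  dot (map_mx intr z) (to_space F a) = (dot z a)%:~R.
Proof.
rewrite /dot !mxE rmorph_sum; apply: eq_bigr => i _.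
by rewrite !mxE rmorphM.
Qed.

(** * Integral forms *)

Section ClearDenominators.

Lemma clear_denominators m n (q : 'M[rat]_(m, n)) :
  exists2 N : int, N != 0 & exists z : 'M[int]_(m, n),
    map_mx intr z = N%:~R *: q.
Proof.
pose den (p : 'I_m * 'I_n) := denq (q p.1 p.2).
exists (\prod_p den p); first by apply/prodf_neq0 => p _; exact: denq_neq0.
exists (\matrix_(i, j) (numq (q i j) * \prod_(p | p != (i, j)) den p)).
apply/matrixP => i j; rewrite !mxE [in RHS](bigD1 (i, j)) //= !intrM numqE.
by rewrite [RHS]mulrC mulrA.
Qed.

(** The values of z on Z^d form a subgroup of Z; G is its positive generator. *)
Lemma primitive_multiple d (z : 'cV[int]_d) : z != 0 ->
  exists z' (G : int) (x : 'Z^d), [/\ z = G *: z', 0 < G & dot z' x = 1].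
Proof.
move=> z0.
pose P n := `[< (0 < n)%N /\ exists x : 'Z^d, dot z x = n%:Z >].
have exP : exists n, P n.
  have [i zi] : exists i, z i 0 != 0.
    apply/existsP; apply: contraNT z0; rewrite negb_exists => /forallP zi.
    by apply/eqP/colP => i; rewrite mxE; apply/eqP; rewrite -[_ == _]negbK.
  exists (absz (z i 0)); apply/asboolP; rewrite absz_gt0; split=> //.
  (* One of the two unit vectors on the i-th axis has value |z_i|. *)
  exists (Num.sg (z i 0) *: delta_mx 0 i).
  by rewrite dotZr dot_delta abszE normrEsg.
case: (ex_minnP exP) => G /asboolP[G0 [x0 x0G]] minG.
have GN0 : G%:Z != 0 by rewrite gt_eqF // ltz_nat.
have divG x : dot z x = (dot z x %/ G)%Z * G%:Z.
  rewrite {1}(divz_eq (dot z x) G%:Z).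
  suff -> : (dot z x %% G)%Z = 0 by rewrite addr0.
  have r0 := modz_ge0 (dot z x) GN0.
  apply/eqP; apply: contraT => rN0.
  have := minG (absz (dot z x %% G)%Z); rewrite leqNgt.
  have -> : (absz (dot z x %% G)%Z < G)%N by rewrite -ltz_nat gez0_abs //
    ltz_pmod.
  apply; apply/asboolP; rewrite absz_gt0; split=> //.
  exists (x - (dot z x %/ G)%Z *: x0).
  by rewrite dotBr dotZr x0G gez0_abs // /modz.
exists (\col_i (z i ord0 %/ G)%Z), G%:Z, x0; split=> //.
  by apply/colP => i; rewrite !mxE -dot_delta mulrC -divG.
have zE : z = G%:Z *: \col_i (z i ord0 %/ G)%Z.
  by apply/colP => i; rewrite !mxE -dot_delta mulrC -divG.
have := x0G; rewrite {1}zE dotZl -[RHS]mulr1 => /mulfI; apply.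
exact: GN0.
Qed.

End ClearDenominators.

Section RowMatrix.
Variables (d : nat) (B : {fset 'Z^d}).

Definition rows (F : pzRingType) : 'M[F]_(size B, d) :=
  \matrix_(i, j) (nth 0 B i 0 j)%:~R.

Lemma rows_mul (F : comPzRingType) (g : 'cV[F]_d) :
  (rows F *m g = 0) <-> (forall a, a \in B -> dot g (to_space F a) = 0).
Proof.
have rowE' i : row i (rows F) = to_space F (nth 0 B i).
  by apply/rowP => j; rewrite !mxE.
split=> [M0 a|B0].
  move=> /(nthP 0)[i iB <-].
  rewrite /dot -(rowE' (Ordinal iB)) -row_mul M0 !mxE //.
apply/colP => i; rewrite [RHS]mxE; apply: etrans (B0 (nth 0 B i) _).
  by rewrite /dot -rowE' -row_mul [RHS]mxE.
exact: mem_nth.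
Qed.

Lemma map_rows (F F' : pzRingType) (f : {rmorphism F -> F'}) :
  map_mx f (rows F) = rows F'.
Proof. by apply/matrixP => i j; rewrite !mxE rmorph_int. Qed.

Lemma mul_rows_Kspan (F : pzRingType) (u : 'rV[F]_(size B)) :
  Kspan B F (u *m rows F).
Proof.
exists (fun a => nth 0 [seq u 0 i | i <- enum 'I_(size B)] (index a B)).
rewrite (big_nth 0) big_mkord; apply/rowP => j; rewrite mxE summxE.
apply: eq_bigr => i _; rewrite !mxE; congr (_ * _).
by rewrite index_uniq ?fset_uniq // (nth_map i) ?size_enum_ord // nth_ord_enum.
Qed.

End RowMatrix.
(** * Supporting forms with many zeros *)

Section Geometry.
Variables (R : realType) (d : nat) (A : {fset 'Z^d}).
Hypothesis genA : Zspan A = setT.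
Implicit Types (g h : 'cV[R]_d) (z : 'cV[int]_d) (a : 'Z^d) (x : 'rV[R]_d).

Local Notation C := (cone A R).
Local Notation "a %:V" := (to_space R a) (at level 2, format "a %:V").

Definition nonneg g := forall a, a \in A -> 0 <= dot g a%:V.

Definition zeros g : {fset 'Z^d} := [fset a in A | dot g a%:V == 0]%fset.

(** For a nonnegative nonzero form this says that its zeros span its
kernel, that is, that it supports a facet. *)
Definition extremal g :=
  forall h, (forall a, a \in zeros g -> dot h a%:V = 0) -> exists k, h = k *: g.

Lemma in_zeros g a : (a \in zeros g) = (a \in A) && (dot g a%:V == 0).
Proof. by rewrite !inE. Qed.

Lemma dot_eq0 g : (forall a, a \in A -> dot g a%:V = 0) -> g = 0.
Proof.
move=> g0; apply/colP => i; rewrite mxE -dot_delta.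
have -> : delta_mx 0 i = (delta_mx 0 i)%:V :> 'rV[R]_d.
  by apply/rowP => j; rewrite !mxE; case: (_ && _).
have : Zspan A (delta_mx 0 i) by rewrite genA.
move=> /(@Zspan_Kspan _ _ R)[c ->]; rewrite linear_sum big_seq big1 // => a aA.
by rewrite linearZ /= g0 // mulr0.
Qed.

Lemma cone_mem a : a \in A -> C a%:V.
Proof.
move=> aA; exists (fun b => (b == a)%:R) => [b|]; first exact: ler0n.
rewrite (big_fsetD1 a) //= eqxx scale1r big_seq big1 ?addr0 // => b.
by rewrite !inE => /andP[/negbTE -> _]; rewrite scale0r.
Qed.

Lemma nonneg_cone g : nonneg g -> forall x, C x -> 0 <= dot g x.
Proof.
move=> g0 _ [c c0 ->]; rewrite linear_sum big_seq sumr_ge0 // => a aA.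
by rewrite linearZ mulr_ge0 ?g0.
Qed.

(** A face is generated by the members of A that it contains. *)
Lemma zeros_cone g h : nonneg g ->
  (forall a, a \in zeros g -> dot h a%:V = 0) ->
  forall x, C x -> dot g x = 0 -> dot h x = 0.
Proof.
move=> g0 h0 _ [c c0 ->]; rewrite !linear_sum => gx.
rewrite big_seq big1 // => a aA; rewrite linearZ /=.
have [ga|ga] := eqVneq (dot g a%:V) 0; first by rewrite h0 ?mulr0 ?in_zeros ?aA
  ?ga /=.
suff -> : c a = 0 by rewrite mul0r.
have := gx; rewrite big_seq => /eqP.
rewrite psumr_eq0 => [|b bA]; last by rewrite linearZ mulr_ge0 ?g0.
move=> /allP /(_ a aA); rewrite aA linearZ /= mulf_eq0 (negbTE ga) orbF.
by move=> /eqP.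
Qed.

Lemma seq_argmin (T : eqType) (f : T -> R) (s : seq T) :
  s != [::] -> exists2 x, x \in s & forall y, y \in s -> f x <= f y.
Proof.
elim: s => // a [|b s] IHs _.
  by exists a; rewrite ?mem_head // => y; rewrite inE => /eqP ->.
have [//|x xs xmin] := IHs; have [ax|xa] := leP (f a) (f x).
  exists a; rewrite ?mem_head // => y; rewrite inE => /predU1P[->//|/xmin].
  exact: le_trans.
exists x; first by rewrite inE xs orbT.
by move=> y; rewrite inE => /predU1P[->|/xmin//]; exact: ltW.
Qed.

(** If g is not extremal, some form h independent of g vanishes on the zeros of
g.  After subtracting a multiple of g one has h = 0 at a0, and up to sign h < 0
somewhere on A.  The form h - r g with r the least value of h / g off the zeros
of g is then nonnegative, acquires a new zero, and is still positive at a0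
because r < 0. *)
Lemma rotate_form g a0 : nonneg g -> a0 \in A -> 0 < dot g a0%:V ->
  ~ extremal g ->
  exists g', [/\ nonneg g', 0 < dot g' a0%:V, (zeros g `<=` zeros g')%fset
     & (#|` zeros g| < #|` zeros g'|)%N].
Proof.
move=> g0 a0A ga0 /existsNP[h0 /not_implyP[h0z h0g]].
pose h1 := h0 - (dot h0 a0%:V / dot g a0%:V) *: g.
have zg a : a \in zeros g -> dot g a%:V = 0 by rewrite in_zeros =>
  /andP[_ /eqP].
have h1E a : dot h1 a%:V =
    dot h0 a%:V - dot h0 a0%:V / dot g a0%:V * dot g a%:V.
  by rewrite /h1 -scaleNr dotDl dotZl mulNr.
have h1z a : a \in zeros g -> dot h1 a%:V = 0.
  by move=> az; rewrite h1E (h0z _ az) (zg _ az) mulr0 subrr.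
have h1a0 : dot h1 a0%:V = 0 by rewrite h1E divfK ?subrr // gt_eqF.
have h1N0 : h1 <> 0.
  move=> h10; apply: h0g; exists (dot h0 a0%:V / dot g a0%:V).
  by apply/eqP; rewrite -subr_eq0; apply/eqP.
have [h [hz ha0 [a1 a1A ha1]]] : exists h,
    [/\ forall a, a \in zeros g -> dot h a%:V = 0, dot h a0%:V = 0
      & exists2 a1, a1 \in A & dot h a1%:V < 0].
  have /existsNP[a1 /not_implyP[a1A /eqP]] :
      ~ forall a, a \in A -> dot h1 a%:V = 0 by move=> /dot_eq0.
  rewrite neq_lt => /orP[ha1|ha1]; first by exists h1; split=> //; exists a1.
  exists (- h1); rewrite -scaleN1r; split.
  - by move=> a az; rewrite dotZl h1z ?mulr0.
  - by rewrite dotZl h1a0 mulr0.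
  - by exists a1 => //; rewrite dotZl mulN1r oppr_lt0.
have gpos a : a \in A -> a \notin zeros g -> 0 < dot g a%:V.
  by move=> aA; rewrite in_zeros aA lt_neqAle g0 // eq_sym => ->.
have a1z : a1 \notin zeros g by apply: contraL ha1 => /hz ->; rewrite ltxx.
have := @seq_argmin _ (fun a => dot h a%:V / dot g a%:V)
  [seq a <- A | a \notin zeros g].
case=> [|a2].
  by apply/eqP => /(congr1 (mem^~ a1)); rewrite /= mem_filter a1z a1A.
rewrite mem_filter => /andP[a2z a2A] a2min.
set r := dot h a2%:V / dot g a2%:V in a2min.
have r0 : r < 0.
  apply: le_lt_trans (a2min a1 _) _; first by rewrite mem_filter a1z.
  by rewrite pmulr_llt0 // invr_gt0 gpos.
have g'E a : dot (h + (- r) *: g) a%:V = dot h a%:V - r * dot g a%:V.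
  by rewrite dotDl dotZl mulNr.
have sub : (zeros g `<=` zeros (h + - r *: g))%fset.
  apply/fsubsetP => a az; rewrite in_zeros g'E (hz _ az) (zg _ az) mulr0 subrr
    eqxx.
  by move: az; rewrite in_zeros => /andP[->].
exists (h + (- r) *: g); split=> //.
- move=> a aA; rewrite g'E; have [az|az] := boolP (a \in zeros g).
    by rewrite (hz _ az) (zg _ az) mulr0 subrr.
  rewrite subr_ge0 -ler_pdivlMr ?gpos //.
  by apply: a2min; rewrite mem_filter az.
- by rewrite g'E ha0 sub0r -mulNr mulr_gt0 // oppr_gt0.
- apply: fproper_ltn_card; rewrite fproperE sub.
  apply/negP => /fsubsetP /(_ a2); rewrite (negbTE a2z) => /implyP.
  rewrite in_zeros a2A g'E /r divfK ?subrr ?eqxx //.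
  by rewrite gt_eqF ?gpos.
Qed.

(** Keeping the value at a0 positive is what later separates a0 from a face by a
facet. *)
Lemma exists_extremal g a0 : nonneg g -> a0 \in A -> 0 < dot g a0%:V ->
  exists g', [/\ nonneg g', 0 < dot g' a0%:V, (zeros g `<=` zeros g')%fset
     & extremal g'].
Proof.
move=> + a0A; have [n] := ubnP (#|` A| - #|` zeros g|)%N.
elim: n g => // n IHn g; rewrite ltnS => len g0 ga0.
have [ext|/(rotate_form g0 a0A ga0)[g' [g'0 g'a0 sub lt]]] :=
  pselect (extremal g).
  by exists g; split=> //; exact: fsubset_refl.
have zA : (#|` zeros g'| <= #|` A|)%N.
  by apply: fsubset_leq_card; apply/fsubsetP => a; rewrite in_zeros => /andP[].
have [|g'' [? ? sub' ?]] := IHn g' _ g'0 g'a0.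
  by apply: leq_trans len; rewrite ltn_sub2l // (leq_trans lt).
by exists g''; split=> //; exact: fsubset_trans sub'.
Qed.

(** The zeros of g are integral vectors, so the solution space of the linear
system they define, which is the line of g, contains a rational vector; its
primitive multiple takes the value 1. *)
Lemma extremal_integral g : extremal g -> g != 0 ->
  exists (z : 'cV[int]_d) (k : R) (x : 'Z^d),
    [/\ map_mx intr z = k *: g, 0 < k & dot z x = 1].
Proof.
move=> ext g0.
have g0z : rows (zeros g) R *m g = 0.
  by apply/rows_mul => a; rewrite in_zeros => /andP[_ /eqP].
have [q qN0 q0] : exists2 q : 'cV[rat]_d, q != 0 & rows (zeros g) rat *m q = 0.
  have nfull : ~~ row_full (rows (zeros g) rat).
    rewrite /row_full -(mxrank_map (ratr : {rmorphism rat ->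
      R})) map_rows -/(row_full _).
    apply: contra g0 => /row_fullP[M MN]; apply/eqP.
    by rewrite -[g]mul1mx -MN -mulmxA g0z mulmx0.
  have : cokermx (rows (zeros g) rat) != 0.
    by rewrite -mxrank_eq0 mxrank_coker subn_eq0 -ltnNge ltn_neqAle nfull
      rank_leq_col.
  move=> /eqP/matrixP coker0; case: (boolP [exists j, col j (cokermx (rows
    (zeros g) rat)) != 0]).
    move=> /existsP[j]; exists (col j (cokermx (rows (zeros g) rat))) => //.
    by rewrite colE mulmxA mulmx_coker mul0mx.
  rewrite negb_exists => /forallP col0; case: coker0 => i j.
  by have := col0 j; rewrite negbK => /eqP /colP /(_ i); rewrite !mxE.
have [N NN0 [z zq]] := clear_denominators q.
have zN0 : z != 0.
  apply: contra qN0 => /eqP z0; move: zq; rewrite z0 map_mx0 => /esym/eqP.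
  by rewrite scaler_eq0 intr_eq0 (negbTE NN0).
have [z' [G [x [zE G0 z'x]]]] := primitive_multiple zN0.
have [k z'k] : exists k : R, map_mx intr z' = k *: g.
  apply: ext => a az; rewrite dot_to_space; apply/eqP; rewrite intr_eq0.
  have : dot z a == 0.
    rewrite -(intr_eq0 rat) -dot_to_space zq dotZl.
    by rewrite ((rows_mul _ _).1 q0) ?mulr0.
  by rewrite zE dotZl mulf_eq0 (gt_eqF G0).
have kN0 : k != 0.
  apply: contra_eq_neq z'k => ->; rewrite scale0r.
  apply/eqP => z'0; have := dot_to_space R z' x.
  by rewrite z'0 z'x /dot mulmx0 mxE => /esym/eqP; rewrite oner_eq0.
have [k0|k0|k0] := ltrgtP 0 k; last by rewrite k0 eqxx in kN0.
  by exists z', k, x.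
exists (- z'), (- k), (- x); split.
- by rewrite scaleNr -z'k; apply/colP => i; rewrite !mxE rmorphN.
- by rewrite oppr_gt0.
- by rewrite /dot mulmxN mulNmx opprK.
Qed.

End Geometry.
(** * Facets of the cone *)

Section Facets.
Variables (R : realType) (d : nat) (A : {fset 'Z^d}).
Hypothesis genA : Zspan A = setT.
Implicit Types (g h : 'cV[R]_d) (z : 'cV[int]_d) (a : 'Z^d) (x : 'rV[R]_d).
Implicit Types (s t : set 'rV[R]_d).

Local Notation C := (cone A R).
Local Notation zR z := (map_mx intr z : 'cV[R]_d).
Local Notation "a %:V" := (to_space R a) (at level 2, format "a %:V").

Definition normal_form z : {scalar 'rV[R]_d} := dot (zR z).

Definition normal_of s z := facet C s /\ facet_form A s (normal_form z).

Definition normal z := exists s, normal_of s z.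

Definition wall z : {fset 'Z^d} := [fset a in A | dot z a == 0]%fset.

Lemma in_wall z a : (a \in wall z) = (a \in A) && (dot z a == 0).
Proof. by rewrite !inE. Qed.

Lemma zeros_wall z : zeros A (zR z) = wall z.
Proof. by apply/fsetP => a; rewrite in_zeros in_wall dot_to_space intr_eq0. Qed.

Lemma faceP t : face C t ->
  exists2 g, nonneg A g & forall x, t x <-> C x /\ dot g x = 0.
Proof.
move=> [l l0 ->]; exists (\col_i l (delta_mx 0 i)) => [a aA|x].
  by rewrite -scalar_dot; apply/l0/cone_mem.
by rewrite /= scalar_dot.
Qed.

Lemma in_on_face t a : (a \in on_face A t) <-> a \in A /\ t a%:V.
Proof.
rewrite !inE; split=> [/andP[aA /set_mem]|[-> ta]] //=.
exact: mem_set.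
Qed.

Lemma on_face_zeros t g : (forall x, t x <-> C x /\ dot g x = 0) ->
  on_face A t = zeros A g.
Proof.
move=> tg; apply/fsetP => a; rewrite in_zeros; apply/idP/andP.
  by move=> /in_on_face[aA /tg[_ /eqP]].
move=> [aA /eqP ga]; apply/in_on_face; split=> //.
by apply/tg; split=> //; exact: cone_mem.
Qed.

Lemma face_sub t t' : face C t -> face C t' ->
  (on_face A t `<=` on_face A t')%fset -> t `<=` t'.
Proof.
move=> /faceP[g g0 tg] /faceP[g' _ tg'].
rewrite (on_face_zeros tg) (on_face_zeros tg') => /fsubsetP sub x /tg[Cx gx].
apply/tg'; split=> //; apply: (zeros_cone g0 _ Cx gx) => a /sub.
by rewrite in_zeros => /andP[_ /eqP].
Qed.

(** Faces are intersections of facets: a0 outside t is separated from t by a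
facet, supported by the extremal form obtained from a form defining t. *)
Lemma exists_facet t a0 : face C t -> a0 \in A -> ~ t a0%:V ->
  exists s z, [/\ normal_of s z, t `<=` s, ~ s a0%:V, on_face A s = wall z
    & extremal A (zR z)].
Proof.
move=> /faceP[g g0 tg] a0A ta0.
have ga0 : 0 < dot g a0%:V.
  rewrite lt_neqAle g0 // andbT eq_sym; apply/eqP => ga0; apply: ta0.
  by apply/tg; split=> //; exact: cone_mem.
have [g' [g'0 g'a0 sub ext]] := exists_extremal genA g0 a0A ga0.
have g'N0 : g' != 0.
  by apply: contraTneq g'a0 => ->; rewrite /dot mulmx0 mxE ltxx.
have [z [k [x [zE k0 zx]]]] := extremal_integral ext g'N0.
pose s := [set x | C x /\ dot g' x = 0].
have sA : on_face A s = wall z.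
  rewrite (@on_face_zeros _ g') // -zeros_wall zE; apply/fsetP => a.
  by rewrite !in_zeros dotZl mulf_eq0 (gt_eqF k0).
exists s, z; split=> //.
- split; first split.
  + exists (dot g' : {scalar 'rV[R]_d}) => [y|]; first exact: nonneg_cone.
    by [].
  + move=> sC; have : s a0%:V by rewrite sC; exact: cone_mem.
    by move=> [_ g'a00]; rewrite g'a00 ltxx in g'a0.
  + move=> t' /faceP[g1 g10 t'g] st'.
    have [k1 g1E] : exists k1, g1 = k1 *: g'.
      apply: ext => a; rewrite in_zeros => /andP[aA /eqP g'a].
      have /st' /t'g[] // : s a%:V by split=> //; exact: cone_mem.
    have [k10|k10] := eqVneq k1 0; [right|left].
      apply/seteqP; split=> y; first by case/t'g.
      by move=> Cy; apply/t'g; rewrite g1E k10 scale0r /dot mulmx0 mxE.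
    apply/seteqP; split=> y; last exact: st'.
    move=> /t'g[Cy]; rewrite g1E dotZl => /eqP.
    by rewrite mulf_eq0 (negbTE k10) => /eqP.
  split=> [y Cy|y [_ g'y]|].
  + rewrite /normal_form /= zE dotZl mulr_ge0 ?(ltW k0) //.
    exact: (nonneg_cone g'0 Cy).
  + by rewrite /normal_form /= zE dotZl g'y mulr0.
  + apply/seteqP; split=> [_ [a _ <-]|_ [n _ <-]].
      by exists (dot z a); rewrite // /normal_form /= dot_to_space.
    exists (n *: x) => //.
    by rewrite /normal_form /= dot_to_space dotZr zx mulr1.
- move=> y /tg[Cy gy]; split=> //; apply: (zeros_cone g0 _ Cy gy) => a.
  by move=> /(fsubsetP sub); rewrite in_zeros => /andP[_ /eqP].
- by move=> [_ g'a00]; rewrite g'a00 ltxx in g'a0.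
- move=> h hz; have [|k1 ->] := ext h.
    by move=> a; rewrite -(on_face_zeros (t := s)) // sA -zeros_wall; exact: hz.
  by exists (k1 / k); rewrite zE scalerA divfK ?gt_eqF.
Qed.

Lemma normal_one z : normal z -> exists x : 'Z^d, dot z x = 1.
Proof.
move=> [s [_ [_ _ zT]]]; have : (range (fun n : int =>
  n%:~R : R)) 1 by exists 1.
rewrite -zT => -[x _]; rewrite /normal_form /= dot_to_space => /eqP.
by rewrite (eqr_int R _ 1) => /eqP; exists x.
Qed.

Lemma normal_ge0 z a : normal z -> a \in A -> 0 <= dot z a.
Proof.
move=> [s [_ [z0 _ _]]] aA; have := z0 _ (cone_mem R aA).
by rewrite /normal_form /= dot_to_space ler0z.
Qed.

Lemma normal_pos z : normal z -> exists2 a, a \in A & 0 < dot z a.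
Proof.
move=> nz; have [x zx] := normal_one nz; apply: contrapT => noa.
have : zR z = 0.
  apply: (dot_eq0 genA) => a aA; rewrite dot_to_space.
  have := normal_ge0 nz aA; rewrite le_eqVlt => /predU1P[<-//|za].
  by case: noa; exists a.
move=> zR0; have := dot_to_space R z x.
by rewrite zR0 zx /dot mulmx0 mxE => /esym/eqP; rewrite oner_eq0.
Qed.

(** Separating from s a member of A on which z is positive yields a facet
containing s, hence s itself; so the form of s is proportional to an extremal
one. *)
Lemma normal_of_wall s z : normal_of s z ->
  on_face A s = wall z /\ extremal A (zR z).
Proof.
move=> nsz; have nz : normal z by exists s.
have [[face_s sC max_s] [z0 zs zT]] := nsz.
have [a aA za] := normal_pos nz.
have sa : ~ s a%:V.
  by move=> /zs; rewrite /normal_form /= dot_to_space => /eqP;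
    rewrite intr_eq0 gt_eqF.
have [s' [z' [[[face_s' s'C _] _] ss' s'a s'z' ext]]] :=
  exists_facet face_s aA sa.
have s's : s' = s by case: (max_s _ face_s' ss').
have [k zk] : exists k, zR z = k *: zR z'.
  apply: ext => b; rewrite zeros_wall -s'z' s's => /in_on_face[_ /zs].
  by [].
have k0 : k != 0.
  apply: contraTneq za => k0; rewrite -(ltr0z R) -dot_to_space zk k0 scale0r.
  by rewrite /dot mulmx0 mxE ltxx.
have wz : wall z = wall z'.
  rewrite -!zeros_wall; apply/fsetP => b; rewrite !in_zeros zk dotZl mulf_eq0.
  by rewrite (negbTE k0).
split; first by rewrite wz -s'z' s's.
move=> h hz; have [|k1 ->] := ext h.
  by move=> b; rewrite zeros_wall -wz -zeros_wall; exact: hz.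
by exists (k1 / k); rewrite zk scalerA divfK.
Qed.

Lemma normal_facet z : normal z -> exists2 s, facet C s & on_face A s = wall z.
Proof. by move=> [s nsz]; exists s; [case: nsz | case: (normal_of_wall nsz)].
  Qed.

Lemma facet_normal s : facet C s -> exists2 z, normal z & on_face A s = wall z.
Proof.
move=> facet_s; have [face_s sC max_s] := facet_s.
have [a /not_implyP[aA sa]] : exists a, ~ (a \in A -> s a%:V).
  apply/existsNP => sA; apply: sC; have /faceP[g g0 sg] := face_s.
  apply/seteqP; split=> x; first by case/sg.
  move=> Cx; apply/sg; split=> //.
  by rewrite (dot_eq0 genA (g := g)) ?/dot ?mulmx0 ?mxE // => b /sA /sg[].
have [s' [z [nz ss' s'a s'z ext]]] := exists_facet face_s aA sa.
have s's : s' = s.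
  by case: nz => -[face_s' s'C _] _; case: (max_s _ face_s' ss').
by exists z; [exists s' | rewrite -s's].
Qed.

Lemma face_normal t a0 : face C t -> a0 \in A -> a0 \notin on_face A t ->
  exists z, [/\ normal z, (on_face A t `<=` wall z)%fset & 0 < dot z a0].
Proof.
move=> face_t a0A ta0.
have [|s [z [nz ts sa0 sz _]]] := exists_facet face_t a0A.
  by move=> ta; move/negP: ta0; apply; apply/in_on_face.
have nz' : normal z by exists s.
exists z; split=> //.
  rewrite -sz; apply/fsubsetP => a /in_on_face[aA /ts sa].
  exact/in_on_face.
rewrite lt_neqAle normal_ge0 // andbT eq_sym; apply/negP => za.
by apply: sa0; have /in_on_face[] : a0 \in on_face A s by rewrite sz in_wall
  a0A.
Qed.

(** The two forms are proportional, and both are primitive and nonnegative. *)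
Lemma normal_inj z z' : normal z -> normal z' ->
  (wall z `<=` wall z')%fset -> z = z'.
Proof.
move=> nz nz' /fsubsetP sub.
have [k z'k] : exists k, zR z' = k *: zR z.
  case: nz => s /normal_of_wall[_ ext]; apply: ext => a.
  by rewrite zeros_wall dot_to_space => /sub;
    rewrite in_wall => /andP[_ /eqP->].
have [x zx] := normal_one nz; have [x' z'x'] := normal_one nz'.
have kE : k = (dot z' x)%:~R.
  by rewrite -dot_to_space z'k dotZl dot_to_space zx mulr1.
have k1 : k * (dot z x')%:~R = 1.
  by rewrite -dot_to_space -dotZl -z'k dot_to_space z'x'.
have [a aA za] := normal_pos nz.
have k0 : 0 <= k.
  have := normal_ge0 nz' aA; rewrite -(ler0z R) -dot_to_space z'k dotZl.
  by rewrite dot_to_space pmulr_lge0 // ltr0z.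
have {}k1 : k = 1.
  move: k1 k0; rewrite kE -intrM ler0z mulrC => /eqP; rewrite (eqr_int R _ 1).
  move=> /eqP /intUnitRing.unitzPl; rewrite qualifE /= => /orP[] /eqP -> //.
apply/colP => i; apply/eqP; rewrite -(eqr_int R).
by move/colP: z'k => /(_ i); rewrite k1 scale1r !mxE => ->.
Qed.

Lemma finite_normals : exists zs : seq 'cV[int]_d, forall z, normal z ->
  z \in zs.
Proof.
have /choice[h hP] : forall B : {fset 'Z^d}, exists z, forall z', normal z' ->
    wall z' = B -> z' = z.
  move=> B; have [[z [nz zB]]|no] := pselect (exists z, normal z /\ wall z = B).
    exists z => z' nz' z'B; apply: (normal_inj nz' nz).
    by rewrite z'B zB fsubset_refl.
  by exists 0 => z' nz' z'B; case: no; exists z'.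
exists [seq h B | B <- fpowerset A] => z nz; apply/mapP; exists (wall z).
  by rewrite fpowersetE; apply/fsubsetP => a; rewrite in_wall => /andP[].
exact: hP.
Qed.

(** The wall spans the hyperplane of z over the reals; both being rational, it
does so over Q, and after clearing denominators over K. *)
Lemma wall_span (K : fieldType) z : [pchar K] =i pred0 -> normal z ->
  forall y : 'Z^d, dot z y = 0 -> Kspan (wall z) K (to_space K y).
Proof.
move=> charK [s /normal_of_wall[_ ext]] y zy.
have : (to_space R y <= rows (wall z) R)%MS.
  rewrite submxE; apply/eqP/rowP => j; rewrite [RHS]mxE.
  have [|k kE] := ext (col j (cokermx (rows (wall z) R))).
    rewrite zeros_wall; apply/rows_mul.
    by rewrite colE mulmxA mulmx_coker mul0mx.
  transitivity (dot (col j (cokermx (rows (wall z) R))) y%:V).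
    transitivity (col j (y%:V *m cokermx (rows (wall z) R)) 0 0).
      by rewrite [RHS]mxE.
    by rewrite colE -mulmxA -colE.
  by rewrite kE dotZl dot_to_space zy mulr0.
have -> : y%:V = map_mx (ratr : {rmorphism rat -> R}) (to_space rat y).
  by apply/rowP => i; rewrite !mxE /= ratr_int.
rewrite -(map_rows _ (ratr : {rmorphism rat -> R})) map_submx.
move=> /submxP[u yu].
have [N N0 [w wu]] := clear_denominators u.
have NK : N%:~R != 0 :> K.
  by rewrite -(inj_eq (intr_inj_char0 charK)) in N0.
have yw : N *: y = w *m rows (wall z) int.
  apply/rowP => i; apply/eqP; rewrite -(eqr_int rat); apply/eqP.
  have := congr1 (fun M : 'rV_d => (N%:~R *: M) 0 i) yu.
  rewrite scalemxAl -wu -(map_rows _ (intr : {rmorphism int -> rat})) -map_mxM.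
  by rewrite !mxE rmorphM.
have -> : to_space K y = N%:~R^-1 *: (map_mx intr w *m rows (wall z) K).
  rewrite -(map_rows _ (intr : {rmorphism int -> K})) -map_mxM -yw.
  by apply/rowP => i; rewrite !mxE rmorphM mulKf.
by apply: KspanZ; exact: mul_rows_Kspan.
Qed.

(** A facet form takes integral values on the unit vectors, hence has integral
coefficients. *)
Lemma facet_form_normal s (F : {scalar 'rV[R]_d}) :
  facet C s -> facet_form A s F ->
  exists2 z, normal z & F =1 normal_form z.
Proof.
move=> facet_s [F0 Fs FT].
have /choice[z zF] : forall i, exists n : int, F (delta_mx 0 i) = n%:~R.
  move=> i; have : range (fun n : int => n%:~R : R) (F (delta_mx 0 i)).
    rewrite -FT; exists (delta_mx 0 i) => //; congr (F _).
    by apply/rowP => j; rewrite !mxE; case: (_ && _).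
  by move=> [n _ <-]; exists n.
have Fz : F =1 normal_form (\col_i z i).
  move=> x; rewrite scalar_dot /normal_form /=; congr (dot _ x).
  by apply/colP => i; rewrite !mxE zF.
exists (\col_i z i) => //; exists s; split=> //; split=> [x Cx|x sx|].
- by rewrite -Fz F0.
- by rewrite -Fz Fs.
- by rewrite -FT; apply/seteqP; split=> _ [a aT <-]; exists a.
Qed.

Lemma scored_normals Sc (x : 'Z^d) : scored R A Sc ->
  (forall z, normal z -> exists2 y, Sc y & dot z y = dot z x) -> Sc x.
Proof.
move=> ScE Scx; rewrite ScE => s F facet_s form_F.
have [z nz Fz] := facet_form_normal facet_s form_F.
have [y Sy zy] := Scx z nz.
by exists y => //; rewrite !Fz /normal_form /= !dot_to_space zy.
Qed.

Lemma normal_values (S Sc : set 'Z^d) :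
  (forall s F, facet C s -> facet_form A s F ->
     form_values F S = form_values F Sc) ->
  forall z y, normal z -> Sc y -> exists2 x, S x & dot z x = dot z y.
Proof.
move=> valS z y [s [facet_s form_z]] Sy.
have : form_values (normal_form z) S (normal_form z y%:V).
  by rewrite (valS s) //; exists y.
move=> [x Sx]; rewrite /normal_form /= !dot_to_space => /eqP.
by rewrite eqr_int => /eqP; exists x.
Qed.

End Facets.
(** * Values of facet forms on N A-sets *)

Lemma eventually_seq (T : eqType) (P : T -> nat -> Prop) (s : seq T) :
  (forall x, x \in s -> exists N, forall n, (N <= n)%N -> P x n) ->
  exists N, forall x, x \in s -> forall n, (N <= n)%N -> P x n.
Proof.
elim: s => [|a s IHs] Ps; first by exists 0%N.
have [N1 N1P] := Ps a (mem_head _ _).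
have [|N2 N2P] := IHs; first by move=> x xs; apply: Ps; rewrite inE xs orbT.
exists (maxn N1 N2) => x; rewrite inE => /predU1P[->|xs] n; rewrite geq_max.
  by move=> /andP[? _]; exact: N1P.
by move=> /andP[_ ?]; exact: N2P.
Qed.

Section Spans.
Variables (d : nat).
Implicit Types (B : {fset 'Z^d}) (x y a : 'Z^d) (z : 'cV[int]_d).

Lemma ZspanD B x y : Zspan B x -> Zspan B y -> Zspan B (x + y).
Proof.
move=> [n ->] [k ->]; exists (fun a => n a + k a).
by rewrite -big_split; apply: eq_bigr => a _; rewrite mulrzDr.
Qed.

Lemma ZspanN B x : Zspan B x -> Zspan B (- x).
Proof.
move=> [n ->]; exists (fun a => - n a).
by rewrite -sumrN; apply: eq_bigr => a _; rewrite mulrNz.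
Qed.

Lemma ZspanB B x y : Zspan B x -> Zspan B y -> Zspan B (x - y).
Proof. by move=> Bx By; apply: ZspanD => //; exact: ZspanN. Qed.

Lemma Zspan_sum B (n : 'Z^d -> int) : Zspan B (\sum_(a <- B) a *~ n a).
Proof. by exists n. Qed.

Lemma Zspan_subset B B' x : (B `<=` B')%fset -> Zspan B x -> Zspan B' x.
Proof.
move=> BB' [c ->]; exists (fun a => if a \in B then c a else 0).
rewrite -[RHS](big_fset_incl _ BB') /=; last first.
  by move=> a _ /negbTE ->; rewrite mulr0z.
by apply: eq_big_seq => a ->.
Qed.

Lemma Nspan_subset B A (n : 'Z^d -> nat) : (B `<=` A)%fset ->
  Nspan A (\sum_(a <- B) a *+ n a).
Proof.
move=> BA; exists (fun a => if a \in B then n a else 0%N).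
rewrite -[RHS](big_fset_incl _ BA) /=; last first.
  by move=> a _ /negbTE ->; rewrite mulr0n.
by apply: eq_big_seq => a ->.
Qed.

Lemma dot_Zspan A z B x : (B `<=` wall A z)%fset -> Zspan B x -> dot z x = 0.
Proof.
move=> /fsubsetP BA [n ->]; rewrite dot_sumr big_seq big1 // => a /BA.
by rewrite in_wall => /andP[_ /eqP za]; rewrite dotMz za mul0rz.
Qed.

Lemma dot_Kspan (K : fieldType) A z B x : [pchar K] =i pred0 ->
  (B `<=` wall A z)%fset -> Kspan B K (to_space K x) -> dot z x = 0.
Proof.
move=> charK /fsubsetP BA [c xc]; apply: (intr_inj_char0 charK).
rewrite -dot_to_space xc dot_sumr big_seq big1 // => a /BA.
rewrite in_wall => /andP[_ /eqP za].
by rewrite dotZr dot_to_space za mulr0.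
Qed.

Lemma addset_shift (S : set 'Z^d) B x y :
  Zspan B y -> addset S (Zspan B) x -> addset S (Zspan B) (x + y).
Proof.
move=> By [s Ss [w Bw <-]]; exists s => //; exists (w + y); last exact: addrA.
exact: ZspanD.
Qed.

End Spans.

Section NASetValues.
Variables (R : realType) (d : nat) (A : {fset 'Z^d}).
Hypothesis genA : Zspan A = setT.
Implicit Types (z : 'cV[int]_d) (B : {fset 'Z^d}).

Lemma eventually_normals (P : 'cV[int]_d -> nat -> Prop) :
  (forall z, normal R A z -> exists N, forall n, (N <= n)%N -> P z n) ->
  exists N, forall z, normal R A z -> forall n, (N <= n)%N -> P z n.
Proof.
move=> PN; have [zs zsP] := finite_normals R genA.
have [|N NP] := @eventually_seq _ (fun z n => normal R A z -> P z n) zs.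
  move=> z _; have [nz|nz] := pselect (normal R A z).
    by have [N NP] := PN z nz; exists N => n /NP.
  by exists 0%N.
by exists N => z nz n Nn; apply: NP => //; exact: zsP.
Qed.

Lemma NAset_sum (T : set 'Z^d) B x (n : 'Z^d -> nat) : NAset A T ->
  (B `<=` A)%fset -> T x -> T (x + \sum_(a <- B) a *~ (n a)%:Z).
Proof.
move=> TA BA Tx; apply: TA; exists x => //.
by exists (\sum_(a <- B) a *+ n a); first exact: Nspan_subset.
Qed.

Lemma normal_sum_ge z B (n : 'Z^d -> nat) N a0 : normal R A z ->
  (B `<=` A)%fset -> a0 \in B -> 0 < dot z a0 -> (forall a, (N <= n a)%N) ->
  N%:Z <= dot z (\sum_(a <- B) a *~ (n a)%:Z).
Proof.
move=> nz /fsubsetP BA a0B za0 nN; rewrite dot_sumr (big_fsetD1 a0) //=.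
rewrite -[leLHS]addr0 lerD //.
  rewrite dotMz -mulrzr intz -[leLHS]mul1r ler_pM //.
  by rewrite lez_nat.
rewrite big_seq sumr_ge0 // => a; rewrite !inE => /andP[_ aB].
by rewrite dotMz mulrz_ge0 // (normal_ge0 nz) ?BA.
Qed.

Lemma fin_gen_lower (T : set 'Z^d) z : fin_gen A T -> normal R A z ->
  exists L, forall y, T y -> L <= dot z y.
Proof.
move=> [G ->] nz; exists (- \sum_(g <- G) `|dot z g|) => _ [g Gg [w [n ->] <-]].
rewrite dotDr -[leLHS]addr0 lerD //; last first.
  rewrite dot_sumr big_seq sumr_ge0 // => a aA.
  by rewrite dotMn mulrn_wge0 // (normal_ge0 nz).
rewrite (big_fsetD1 g) //= lerNl (le_trans (ler_norm _)) // normrN.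
by rewrite lerDl sumr_ge0.
Qed.

(** Since z takes the value 1 on Z A, it takes two consecutive values v and
v + 1 on the monoid N A, and these generate every integer from v^2 on. *)
Lemma values_cofinal (T : set 'Z^d) z : NAset A T -> T !=set0 -> normal R A z ->
  exists L : int, forall k, L <= k -> exists2 y, T y & dot z y = k.
Proof.
move=> TA [y0 Ty0] nz; have [x zx] := normal_one nz.
have [n xn] : Zspan A x by rewrite genA.
(* x = p - q splits the coefficients of x by sign; v above is the value at q. *)
pose n1 a := if 0 <= n a then absz (n a) else 0%N.
pose n2 a := if 0 <= n a then 0%N else absz (n a).
pose p := \sum_(a <- A) a *+ n1 a; pose q := \sum_(a <- A) a *+ n2 a.
have pq : x = p - q.
  rewrite xn /p /q -sumrB; apply: eq_bigr => a _.
  rewrite /n1 /n2; case: ifP => na.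
    by rewrite mulr0n subr0 pmulrn gez0_abs.
  rewrite mulr0n sub0r pmulrn ltz0_abs ?mulrNz ?opprK // ltNge na //.
have zp : dot z p = dot z q + 1 by rewrite -zx pq dotBr addrC subrK.
have zq0 : 0 <= dot z q.
  rewrite dot_sumr big_seq sumr_ge0 // => a aA.
  by rewrite dotMn mulrn_wge0 // (normal_ge0 nz).
have Tpq u v : T (y0 + (p *+ u + q *+ v)).
  apply: TA; exists y0 => //; exists (p *+ u + q *+ v) => //.
  exists (fun a => n1 a * u + n2 a * v)%N.
  rewrite /p /q -!sumrMnl -big_split; apply: eq_bigr => a _.
  by rewrite mulrnDr !mulrnA.
have zpq u v : dot z (y0 + (p *+ u + q *+ v)) =
    dot z y0 + ((dot z q + 1) * u%:Z + dot z q * v%:Z).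
  by rewrite !dotDr !dotMn zp -(mulr_natr _ u) -(mulr_natr _ v) !natz.
exists (dot z y0 + dot z q * dot z q) => k Lk.
case: (leP (dot z q) 0) => [q0|q0].
  have {zq0 q0}q0 : dot z q = 0 by apply/eqP; rewrite eq_le q0.
  exists (y0 + (p *+ absz (k - dot z y0) + q *+ 0)); first exact: Tpq.
  rewrite zpq q0 mul0r addr0 add0r mul1r gez0_abs ?subrKC //.
  by rewrite subr_ge0 (le_trans _ Lk) // q0 mulr0 addr0.
set e := k - dot z y0.
have r0 := modz_ge0 e (lt0r_neq0 q0); have rq := ltz_pmod e q0.
have eE := divz_eq e (dot z q).
set r := (e %% dot z q)%Z in r0 rq eE; set w := (e %/ dot z q)%Z in eE.
(* e = w v + r = r (v + 1) + (w - r) v, where r < v <= w. *)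
have wr : r <= w.
  have : dot z q <= w by rewrite lez_divRL // lerBrDl.
  by apply: le_trans; exact: ltW.
clearbody r w; exists (y0 + (p *+ absz r + q *+ absz (w - r)));
  first exact: Tpq.
rewrite zpq (gez0_abs r0) gez0_abs; last by rewrite subr_ge0.
transitivity (dot z y0 + e).
  congr (_ + _); rewrite eE mulrDl mul1r mulrBr [LHS]addrC [LHS]addrA subrK.
  by rewrite mulrC.
by rewrite addrC subrK.
Qed.

End NASetValues.
(** * The exceptional sets of S and of the complement of - omega(S) *)

Local Ltac row_ring := apply/rowP => ?; rewrite !mxE; ring.

Section Exceptional.
Variables (R : realType) (K : fieldType) (d : nat) (A : {fset 'Z^d}).
Hypotheses (charK : [pchar K] =i pred0) (genA : Zspan A = setT).
Variables (Sc : set 'Z^d) (m : nat) (b : 'I_m -> 'Z^d).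
Variables (tau : 'I_m -> set 'rV[R]_d) (S : set 'Z^d).
Variable (bt : set 'rV[R]_d -> 'Z^d).
Hypotheses (Sc_NA : NAset A Sc) (Sc_fg : fin_gen A Sc).
Hypotheses (Sc_scored : scored R A Sc) (S_NA : NAset A S).
Hypothesis tau_face : forall i, face (cone A R) (tau i).
Hypothesis defS : S = Sc `\` \bigcup_i hole A b tau i.
Hypothesis valS : forall s F, facet (cone A R) s -> facet_form A s F ->
  form_values F S = form_values F Sc.
Hypothesis btB : calB A b tau K bt.
Implicit Types (z : 'cV[int]_d) (a x y : 'Z^d) (i : 'I_m) (t : set 'rV[R]_d).

Local Notation C := (cone A R).
Local Notation normal := (normal R A).
Local Notation wall := (wall A).
Local Notation Ftilde := (Ftilde A tau).

Definition value z x := exists2 y, S y & dot z y = dot z x.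

(** This is the complement of - omega(S). *)
Definition coomega : set 'Z^d :=
  [set x | exists2 t, Ftilde t & addset S (Zspan (on_face A t)) (x - bt t)].

(** The points that leave S under translation by a do so either through the
value of a facet form or by falling into a hole; those of the second kind are
enlarged to the lattice points of their Zariski closure. *)
Definition exceptional a x :=
  (exists z, [/\ normal z, value z x & ~ value z (x + a)]) \/
  (exists i, addset S (Zspan (on_face A (tau i))) (b i - a) /\
     Kspan (on_face A (tau i)) K (to_space K (x - (b i - a)))).

Lemma S_sub x : S x -> Sc x.
Proof. by rewrite defS => -[]. Qed.

Lemma S_hole i x : S x -> ~ Zspan (on_face A (tau i)) (x - b i).
Proof.
rewrite defS => -[_ nh] xi; apply: nh; exists i => //.
by exists (b i) => //; exists (x - b i) => //; rewrite addrC subrK.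
Qed.

Lemma S_of_values x : (forall z, normal z -> value z x) ->
  (forall i, ~ Zspan (on_face A (tau i)) (x - b i)) -> S x.
Proof.
move=> vx hx; rewrite defS; split.
  apply: (scored_normals Sc_scored) => z /vx[y Sy zy].
  by exists y => //; exact: S_sub.
by move=> [i _ [_ -> [w Bw wx]]]; apply: (hx i); rewrite -wx addrC addKr.
Qed.

Lemma value_Sc z x : normal z -> (exists2 y, Sc y & dot z y = dot z x) ->
  value z x.
Proof.
by move=> nz [y Sy zy]; have [s Ss zs] := normal_values valS nz Sy; exists s;
  rewrite ?zs.
Qed.

Lemma on_face_sub t : (on_face A t `<=` A)%fset.
Proof. by apply/fsubsetP => a /in_on_face[]. Qed.

Lemma wall_sub z : (wall z `<=` A)%fset.
Proof. by apply/fsubsetP => a; rewrite in_wall => /andP[]. Qed.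

Lemma Ftilde_face t : Ftilde t -> face C t.
Proof. by move=> [[]//|[i _ <-]]. Qed.

Lemma Ftilde_proper t : S !=set0 -> Ftilde t ->
  exists2 a, a \in A & a \notin on_face A t.
Proof.
move=> [y Sy] [facet_t|[i _ <-]].
  have [z nz ->] := facet_normal genA facet_t.
  have [a aA za] := normal_pos genA nz.
  by exists a => //; rewrite in_wall (gt_eqF za) andbF.
apply: contrapT => noa; have Ai : (A `<=` on_face A (tau i))%fset.
  apply/fsubsetP => a aA; apply: contrapT => ai; apply: noa.
  by exists a => //; apply/negP.
by apply: (@S_hole i _ Sy); apply: (Zspan_subset Ai); rewrite genA.
Qed.

Lemma dot_bt t z : Ftilde t -> (on_face A t `<=` wall z)%fset ->
  dot z (bt t) = 0.
Proof.
by move=> Ft tz; apply: (dot_Kspan charK tz); case: btB => /(_ t Ft).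
Qed.

(** Far out in the direction of t, the forms not vanishing on t impose no
condition, and the holes not containing the direction of t are avoided. *)
Lemma mem_translate t x : face C t -> S !=set0 ->
  (forall z, normal z -> (on_face A t `<=` wall z)%fset -> value z x) ->
  (forall i, (on_face A t `<=` on_face A (tau i))%fset ->
     ~ Zspan (on_face A (tau i)) (x - b i)) ->
  addset S (Zspan (on_face A t)) x.
Proof.
move=> face_t [y0 Sy0] vx hx; set B := on_face A t in vx hx *.
have BA : (B `<=` A)%fset := on_face_sub t.
pose p n := x + \sum_(a <- B) a *~ n%:Z.
have zp z n : dot z (p n) = dot z x + dot z (\sum_(a <- B) a *~ n%:Z).
  by rewrite dotDr.
have [N1 N1P] : exists N, forall z, normal z -> forall n, (N <= n)%N ->
    value z (p n).
  apply: (eventually_normals genA) => z nz.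
  have [Bz|/fsubsetPn[a0 a0B a0z]] := boolP (B `<=` wall z)%fset.
    exists 0%N => n _; have [s Ss zs] := vx z nz Bz; exists s => //.
    by rewrite zp zs (dot_Zspan Bz (Zspan_sum _ _)) addr0.
  have za0 : 0 < dot z a0.
    move: a0z; rewrite in_wall (fsubsetP BA) //= lt_neqAle eq_sym => ->.
    by rewrite (normal_ge0 nz) ?(fsubsetP BA).
  have [|L LP] := values_cofinal genA Sc_NA _ nz.
    by exists y0; exact: S_sub.
  exists (absz (L - dot z x)) => n Ln; apply: value_Sc => //; apply: LP.
  rewrite zp -lerBlDl (le_trans (ler_norm _)) //.
  rewrite -abszE (@le_trans _ _ n%:Z) ?lez_nat //.
  exact: (normal_sum_ge nz BA a0B za0 (n := fun=> n)).
have [N2 N2P] : exists N, forall i, i \in enum 'I_m -> forall n, (N <= n)%N ->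
    ~ Zspan (on_face A (tau i)) (p n - b i).
  apply: eventually_seq => i _.
  have [Bi|/fsubsetPn[a0 a0B a0i]] := boolP (B `<=` on_face A (tau i))%fset.
    exists 0%N => n _ pi; apply: (hx i Bi).
    rewrite (_ : x - b i = p n - b i - \sum_(a <- B) a *~ n%:Z).
      by apply: ZspanB => //; apply: (Zspan_subset Bi); exact: Zspan_sum.
    by rewrite /p addrAC addrK.
  have [z [nz iz za0]] :=
    face_normal genA (tau_face i) (fsubsetP BA _ a0B) a0i.
  exists (absz (dot z (b i - x))).+1 => n Ln /(dot_Zspan iz)/eqP.
  rewrite dotBr zp subr_eq0 => /eqP pb.
  have := normal_sum_ge nz BA a0B za0 (n := fun=> n) (fun=> leqnn n).
  rewrite -(lerD2l (dot z x)) pb -lerBrDl -dotBr => nb.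
  move: Ln; rewrite -ltz_nat abszE => /(le_lt_trans (ler_norm _)).
  by rewrite ltNge nb.
exists (p (maxn N1 N2)).
  apply: S_of_values => [z nz|i]; first by apply: N1P; rewrite ?leq_maxl.
  by apply: N2P; rewrite ?mem_enum ?leq_maxr.
exists (- \sum_(a <- B) a *~ (maxn N1 N2)%:Z); last by rewrite /p addrK.
by apply: ZspanN; exact: Zspan_sum.
Qed.

Lemma S_exceptional a x : S x -> ~ S (x + a) -> exceptional a x.
Proof.
move=> Sx Sxa; apply: contrapT => /not_orP[/forallNP noz /forallNP noi].
apply: Sxa; apply: S_of_values => [z nz|i xi].
  apply: contrapT => vz; apply: (noz z); split=> //; by exists x.
apply: (noi i); split.
  exists x => //; exists (- (x + a - b i)); first exact: ZspanN.
  row_ring.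
apply: Zspan_Kspan; rewrite (_ : _ - _ = x + a - b i) //; row_ring.
Qed.

(** Adding combinations of the wall of z, or of A on tau_i, keeps a point in S,
while its translate by a keeps its value under z, respectively stays in the
i-th hole. *)
Lemma S_dense f a : polyfun f ->
  (forall x, S x -> ~ S (x + a) -> f (to_space K x) = 0) ->
  forall x, exceptional a x -> f (to_space K x) = 0.
Proof.
move=> pf f0 x [[z [nz [y Sy zy] vxa]]|[i [[s Ss [w iw sw]] xi]]].
  apply: (@polyfun_zero_span _ _ charK f (wall z) 1 0 y) => //; last first.
    by apply: (wall_span genA charK nz); rewrite dotBr zy subrr.
  move=> n; set v := \sum_(_ <- _) _.
  have zv : dot z v = 0.
    by apply: (dot_Zspan (fsubset_refl (wall z))); exact: Zspan_sum.
  apply: f0 => [|Syva].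
    rewrite /v; under eq_bigr do rewrite mul1r add0n.
    exact: (NAset_sum _ S_NA (wall_sub z)).
  by apply: vxa; exists (y + v + a) => //; rewrite !dotDr zv addr0 zy.
apply: (@polyfun_zero_span _ _ charK f (on_face A (tau i)) 1 0 s) => //;
  last first.
  rewrite (_ : x - s = x - (b i - a) + w); last by rewrite -sw; row_ring.
  by rewrite to_spaceD; apply: KspanD => //; exact: Zspan_Kspan.
move=> n; set v := \sum_(_ <- _) _.
have iv : Zspan (on_face A (tau i)) v by exact: Zspan_sum.
apply: f0 => [|Ssva].
  rewrite /v; under eq_bigr do rewrite mul1r add0n.
  exact: (NAset_sum _ S_NA (on_face_sub _)).
apply: (S_hole (i := i) Ssva).
rewrite (_ : s + v + a - b i = v - w); first exact: ZspanB.
rewrite (_ : w = b i - a - s); last by rewrite -sw addrC addKr.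
clearbody v; row_ring.
Qed.

Lemma coomega_nonempty x : coomega x -> S !=set0.
Proof. by move=> [t _ [s Ss _]]; exists s. Qed.

(** The forms that decide membership in S + Z(A \cap t) vanish at b_t, and
translation by b_t preserves the affine spaces along the faces containing t. *)
Lemma coomega_exceptional a x : coomega x -> ~ coomega (x + a) ->
  exceptional a x.
Proof.
move=> dx dxa; have S0 := coomega_nonempty dx; case: dx => t Ft.
set B := on_face A t => -[s Ss [w Bw sw]].
apply: contrapT => /not_orP[/forallNP noz /forallNP noi].
apply: dxa; exists t => //; apply: mem_translate => //;
  first exact: Ftilde_face.
  move=> z nz tz; apply: contrapT => vz; apply: (noz z).
  have xz y : dot z (y - bt t) = dot z y by rewrite dotBr (dot_bt Ft tz) subr0.
  split=> //.
    by exists s => //; rewrite -(xz x) -sw dotDr (dot_Zspan tz Bw) addr0.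
  by move=> [y Sy zy]; apply: vz; exists y; rewrite // zy xz.
move=> i ti xi; apply: (noi i); split.
  exists s => //; exists (w - (x + a - bt t - b i)).
    by apply: ZspanB => //; exact: (Zspan_subset ti).
  rewrite addrA sw; row_ring.
rewrite (_ : x - (b i - a) = x + a - bt t - b i + bt t).
  rewrite to_spaceD; apply: KspanD; first exact: Zspan_Kspan.
  by apply: (Kspan_subset ti); case: btB => /(_ t Ft).
row_ring.
Qed.

(** The forms vanishing on t and the holes along t are invariant under
Z(A \cap t), so they certify that a point is outside S + Z(A \cap t). *)
Lemma not_coomega x :
  (forall t, Ftilde t ->
     (exists z, [/\ normal z, (on_face A t `<=` wall z)%fset & ~ value z x]) \/
     (exists2 j, tau j = t & Zspan (on_face A t) (x - bt t - b j))) ->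
  ~ coomega x.
Proof.
move=> nx [t Ft [s Ss [w Bw sw]]].
have [[z [nz tz vz]]|[j jt xj]] := nx t Ft.
  apply: vz; exists s => //.
  rewrite -[x](subrK (bt t)) dotDr (dot_bt Ft tz) -sw dotDr (dot_Zspan tz Bw).
  by rewrite !addr0.
apply: (S_hole (i := j) Ss); rewrite jt.
rewrite (_ : s - b j = x - bt t - b j - w); first exact: ZspanB.
by rewrite -sw [in RHS]addrAC addrK.
Qed.

(** The values of each facet form on S are bounded below. *)
Lemma eventually_value x : exists N, forall z, normal z -> forall n,
  (N <= n)%N -> forall y, dot z y <= dot z x - n%:Z -> ~ value z y.
Proof.
apply: (eventually_normals genA) => z nz.
have [L LP] := fin_gen_lower Sc_fg nz.
exists (absz (dot z x - L)).+1 => n; rewrite -ltz_nat abszE => Ln y yx.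
move=> [s Ss zs]; have := LP s (S_sub Ss); rewrite zs => /le_trans/(_ yx).
rewrite lerBrDr -lerBrDl leNgt => /negP; apply.
exact: le_lt_trans (ler_norm _) Ln.
Qed.

Lemma dot_shift_le z B x N (n : 'Z^d -> nat) a0 : normal z ->
  (B `<=` A)%fset -> a0 \in B -> 0 < dot z a0 ->
  dot z (x + \sum_(a <- B) a *~ (-1 * (N + n a)%N%:Z)) <= dot z x - N%:Z.
Proof.
move=> nz BA a0B za0; rewrite dotDr lerD2l.
under eq_bigr do rewrite mulN1r mulrNz.
rewrite sumrN linearN lerN2.
by apply: (normal_sum_ge nz BA a0B za0) => a; rewrite leq_addr.
Qed.

(** The points go to minus infinity along the facet of z, respectively along
tau_i.  Every t in Ftilde is proper, so it lies on a facet.  In the first case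
that facet is either the one of z, where the value at x + a is missing, or
another one, whose form has become too small.  In the second case either some
facet contains t but not tau_i, and its form has become too small, or tau_i is
a face of t, and the compatibility of the b_t puts x + a - b_t in a hole along
t. *)
Lemma coomega_dense f a : polyfun f ->
  (forall x, coomega x -> ~ coomega (x + a) -> f (to_space K x) = 0) ->
  forall x, exceptional a x -> f (to_space K x) = 0.
Proof.
move=> pf f0 x [[z [nz [y Sy zy] vxa]]|[i [bia xi]]].
  have [t facet_t tz] := normal_facet genA nz.
  have Ft : Ftilde t by left.
  have ztt : dot z (bt t) = 0 by apply: dot_bt => //; rewrite tz fsubset_refl.
  have [N NP] := eventually_value (bt t + y + a).
  apply: (@polyfun_zero_span _ _ charK f (wall z) (-1) N (bt t + y)) => //;
    last first.
    by apply: (wall_span genA charK nz); rewrite dotBr dotDr zy ztt add0r subrr.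
  move=> n; set v := \sum_(_ <- _) _.
  have zv : dot z v = 0.
    by apply: (dot_Zspan (fsubset_refl (wall z))); exact: Zspan_sum.
  apply: f0.
    exists t => //; exists y => //; exists v; first by rewrite tz;
      exact: Zspan_sum.
    row_ring.
  apply: not_coomega => t' Ft'; left.
  have [|a0 a0A a0t'] := @Ftilde_proper t' _ Ft'; first by exists y.
  have [z' [nz' t'z' z'a0]] := face_normal genA (Ftilde_face Ft') a0A a0t'.
  exists z'; split=> //.
  have [zz'|/eqP zz'] := eqVneq z z'.
    rewrite -zz'; move=> [s Ss zs]; apply: vxa; exists s => //.
    by rewrite zs !dotDr ztt zv zy addr0 add0r.
  have [a1 a1z a1z'] : exists2 a1, a1 \in wall z & a1 \notin wall z'.
    by apply/fsubsetPn/negP => /(normal_inj genA nz nz').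
  have a1A : a1 \in A by move: a1z; rewrite in_wall => /andP[].
  apply: (NP z' nz' N (leqnn N)); rewrite addrAC /v.
  apply: (dot_shift_le _ _ _ nz' (wall_sub z) a1z).
  move: a1z'; rewrite in_wall a1A /= lt_neqAle eq_sym => ->.
  by rewrite (normal_ge0 nz').
have Fi : Ftilde (tau i) by right; exists i.
have [s0 Ss0 _] := bia.
set B := on_face A (tau i) in bia xi.
have [N NP] := eventually_value (b i + bt (tau i)).
apply: (@polyfun_zero_span _ _ charK f B (-1) N (bt (tau i) + (b i - a))) =>
  //; last first.
  rewrite (_ : x - _ = x - (b i - a) + -1 *: bt (tau i)); last by row_ring.
  rewrite to_spaceD; apply: KspanD => //; rewrite scaleN1r to_spaceN -scaleN1r.
  by apply: KspanZ; case: btB => /(_ _ Fi).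
move=> n; set v := \sum_(_ <- _) _.
have Bv : Zspan B v by exact: Zspan_sum.
apply: f0.
  exists (tau i) => //; rewrite (_ : _ - _ = b i - a + v); last by clearbody v;
    row_ring.
  exact: addset_shift.
apply: not_coomega => t Ft.
rewrite (_ : _ + a = b i + bt (tau i) + v); last by clearbody v; row_ring.
have [sub|/fsubsetPn[a0 a0B a0t]] := boolP (B `<=` on_face A t)%fset;
  last first.
  left; have a0A : a0 \in A by exact: (fsubsetP (on_face_sub (tau i))).
  have [z [nz tz za0]] := face_normal genA (Ftilde_face Ft) a0A a0t.
  exists z; split=> //; apply: (NP z nz N (leqnn N)); rewrite /v.
  exact: (dot_shift_le _ _ _ nz (on_face_sub _) a0B).
right; have face_ti : face t (tau i).
  have tt : tau i `<=` t by apply: face_sub sub => //; exact: Ftilde_face.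
  have [l l0 tl] := tau_face i.
  have tC : t `<=` C by have [l' _ ->] := Ftilde_face Ft; move=> y [].
  exists l => [y /tC|]; first exact: l0.
  apply/seteqP; split=> y; first by move=> ty; split; [exact: tt | move: ty;
    rewrite tl => -[]].
  by move=> [ty ly]; rewrite tl; split=> //; exact: tC.
have [j jt jw] := (btB.2 i t Ft face_ti).
exists j => //; rewrite jt in jw.
rewrite (_ : _ - _ = b i + bt (tau i) - (b j + bt t) + v).
  by apply: ZspanD => //; exact: (Zspan_subset sub).
by clearbody v; row_ring.
Qed.

Lemma vanish_S_coomega f a : polyfun f ->
  (forall x, S x -> ~ S (x + a) -> f (to_space K x) = 0) <->
  (forall x, coomega x -> ~ coomega (x + a) -> f (to_space K x) = 0).
Proof.
move=> pf; split=> f0 x Tx Txa.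
  by apply: (S_dense pf f0); exact: coomega_exceptional Txa.
by apply: (coomega_dense pf f0); exact: S_exceptional Txa.
Qed.

End Exceptional.

Theorem theorem6p11 (R : realType) (K : closedFieldType)
    (charK : [pchar K] =i pred0)
    (d : nat) (A : {fset 'Z^d})
    (genA : Zspan A = setT)
    (convA : strongly_convex (cone A R))
    (Sc : set 'Z^d)
    (Sc_NA : NAset A Sc) (Sc_fg : fin_gen A Sc) (Sc_scored : scored R A Sc)
    (m : nat) (b : 'I_m -> 'Z^d) (tau : 'I_m -> set 'rV[R]_d)
    (bSc : forall i, Sc (b i))
    (tau_face : forall i, face (cone A R) (tau i))
    (S : set 'Z^d)
    (defS : S = Sc `\` \bigcup_i hole A b tau i)
    (irredundant : forall i,
       Sc `\` \bigcup_(j in [set j | j <> i]) hole A b tau j <> S)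
    (valS : forall s F, facet (cone A R) s -> facet_form A s F ->
       form_values F S = form_values F Sc)
    (S_NA : NAset A S)
    (bt : set 'rV[R]_d -> 'Z^d)
    (bt_calB : calB A b tau K bt) :
  let W := omega A tau S bt in
  [/\ modules_correspond (diffop K S) (diffop K W)^c,
      ideals_correspond (@left_ideal (diffop K S)) (@right_ideal (diffop K W)),
      modules_correspond (diffop K S)^c (diffop K W) &
      ideals_correspond (@right_ideal (diffop K S)) (@left_ideal (diffop K W))].

Proof.
move=> W.
have WE x : W x <-> ~ coomega A tau S bt (- x).
  split=> [Wx [t Ft St]|nSx t Ft St]; first exact: (Wx t Ft).
  by apply: nSx; exists t.
have [|f [g [fD fM f1 fK gK]]] := @diffop_antiiso K d S W.
  move=> P a tP; have [q pq Pq] := torus_coeff_poly a tP.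
  have SW := vanish_S_coomega charK genA Sc_NA Sc_fg Sc_scored S_NA tau_face
    defS
    valS bt_calB a pq.
  split=> P0 c.
    move=> nWc Wca; rewrite Pq; apply: SW.1 => [x Sx Sxa||].
    - by rewrite -Pq; exact: P0.
    - by apply: contrapT => nc; apply: nWc; apply/WE; rewrite opprK.
    - by move/WE: Wca; rewrite opprK.
  move=> Sc' Sca; rewrite Pq; apply: SW.2 => // x dx dxa.
  rewrite -Pq; apply: P0; first by move/WE; rewrite opprK.
  by apply/WE; rewrite opprK.
exact: ring_antiiso_correspond fD fM f1 fK gK.
Qed.
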